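(* For every ultragraph $\mathcal{G}=(G^{0},\mathcal{G}^{1},r,s)$ without sinks, the ultrapath groupoid $\mathfrak{G}_{\mathcal{G}}$ is amenable.
   Context: **Ultragraphs.** An ultragraph $\mathcal{G}=(G^{0},\mathcal{G}^{1},r,s)$ consists of countable sets $G^{0}$ (vertices) and $\mathcal{G}^{1}$ (edges), a map $s:\mathcal{G}^{1}\to G^{0}$, and a map $r$ from $\mathcal{G}^{1}$ to the power set of $G^{0}$ with $r(e)\neq\emptyset$ for all $e$. $\mathcal{G}^{0}$ is the smallest collection of subsets of $G^{0}$ containing $\{v\}$ ($v\in G^{0}$) and $r(e)$ ($e\in\mathcal{G}^{1}$) and closed under finite unions and intersections. A sink is a vertex $v$ with $s^{-1}(v)=\emptyset$. **Ultrapaths.** A finite path of positive length is $\alpha=e_1\cdots e_k$ with $e_i\in\mathcal{G}^1$, $s(e_{i+1})\in r(e_i)$; $|\alpha|=k$, $s(\alpha)=s(e_1)$, $r(\alpha)=r(e_k)$. $\mathfrak{p}^\infty$ is the set of infinite paths $e_1e_2\cdots$ (same condition), with $s(\gamma)=s(e_1)$. The set $\mathfrak{p}$ of ultrapaths is the disjoint union of $\{A\in\mathcal{G}^0:A\ne\emptyset\}$ (length $0$, $r(A)=s(A)=A$) and the set of pairs $(\alpha,A)$ with $|\alpha|\ge1$, $\emptyset\neq A\in\mathcal{G}^0$, $A\subseteq r(\alpha)$ (length $|\alpha|$, source $s(\alpha)$, range $A$). The product $x\cdot y$ of ultrapaths is defined iff $r(x)\cap s(y)\neq\emptyset$ (a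 vertex is identified with its singleton): $(\alpha,A)\cdot(\beta,B)=(\alpha\beta,B)$; $A\cdot B=A\cap B$; $A\cdot y=y$ if $|y|\ge1$; $(\alpha,A)\cdot B=(\alpha,A\cap B)$. For $\gamma\in\mathfrak{p}^\infty$ with $s(\gamma)\in r(x)$: $(\alpha,A)\cdot\gamma=\alpha\gamma$ and $A\cdot\gamma=\gamma$. **Ultrapath groupoid.** For $x\in\mathfrak{p}$ let $D_x=\{y\in\mathfrak{p}:y=x\cdot y'\text{ for some }y'\in\mathfrak p\}\cup\{\gamma\in\mathfrak{p}^\infty:\gamma=x\cdot\gamma'\text{ for some }\gamma'\in\mathfrak p^\infty\}$. Give $\mathfrak{p}\cup\mathfrak{p}^\infty$ the topology with subbasis all $D_x$ and their complements. A nonempty $A\in\mathcal{G}^0$ is an ultraset if $\widetilde A=\{B\in\mathcal{G}^0:A\subseteq B\}$ is an ultrafilter (maximal among proper filters in $\mathcal{G}^0$); $A$ is an infinite emitter if $\{e\in\mathcal{G}^1:s(e)\in A\}$ is infinite. $Y_\infty$ is the set of ultrapaths $y$ such that $r(y)$ is an ultraset and an infinite emitter, and $X=Y_\infty\cup\mathfrak{p}^\infty$ with the subspace topology. $\mathfrak{G}_{\mathcal{G}}$ is the set of triples $(x\cdot\mu,|x|-|y|,y\cdot\mu)$ with $x,y\in\mathfrak{p}$, $r(x)=r(y)$, $\mu\in\mathfrak{p}\cup\mathfrak{p}^\infty$, the products defined and lying in $X$; multiplication $(a,m,b)(b,n,c)=(a,m+n,c)$, inverse $(a,m,b)^{-1}=(b,-m,a)$,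 unit space $X$ (via $a\leftrightarrow(a,0,a)$), and topology with basis the sets $\{(x\cdot\mu,|x|-|y|,y\cdot\mu)\in\mathfrak{G}_{\mathcal G}: x\cdot\mu\in U\}$ for $U\subseteq X$ open and $x,y\in\mathfrak{p}$ with $r(x)=r(y)$. It is regarded as an $r$-discrete groupoid with counting measures as Haar system. Amenability is in the sense of Renault for $r$-discrete groupoids.
   Formalization: Renault's amenability presupposes local compactness, which can fail here (e.g. G^0=N, s(e_n)=n, r(e_n)=N: X is the Baire space and C_c={0}); when it fails, the functions are only required to be continuous with support proper over the unit space instead of compactly supported. *)

(* Defs.v *)
From HB Require Import structures.
From mathcomp Require Import all_boot all_order all_algebra.
From mathcomp Require Import all_classical all_reals all_analysis.
From mathcomp.real_closed Require Import complex.
From mathcomp Require Import zify.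

Set Implicit Arguments.
Unset Strict Implicit.
Unset Printing Implicit Defensive.
Import Order.TTheory GRing.Theory Num.Theory.
Import numFieldNormedType.Exports.
Local Open Scope classical_set_scope.
Local Open Scope ring_scope.

Record ultragraph := Ultragraph {
  vertex : countType;
  edge : countType;
  esrc : edge -> vertex;
  erng : edge -> set vertex;
  erng_neq0 : forall e, erng e !=set0 }.

Definition no_sinks (G : ultragraph) : Prop :=
  forall v : vertex G, exists e : edge G, esrc e = v.

Section Ultrapaths.
Variable G : ultragraph.
Local Notation V := (vertex G).
Local Notation E := (edge G).

Inductive gvset : set V -> Prop :=
| gvset1 v : gvset [set v]
| gvset_rng e : gvset (erng e)
| gvsetU A B : gvset A -> gvset B -> gvset (A `|` B)
| gvsetI A B : gvset A -> gvset B -> gvset (A `&` B).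

(* Properness is expressed by ~ F set0: when set0 belongs to gvset it is
   equivalent to F <> gvset; it is also the right reading on a graph with a
   single vertex, where set0 need not belong to gvset. *)
Definition proper_gvfilter (F : set (set V)) : Prop :=
  [/\ F !=set0, F `<=` gvset, ~ F set0,
      forall A B, F A -> F B -> F (A `&` B)
    & forall A B, F A -> gvset B -> A `<=` B -> F B].

Definition gvultrafilter (F : set (set V)) : Prop :=
  proper_gvfilter F /\
  forall F', proper_gvfilter F' -> F `<=` F' -> F' = F.

Definition ultraset (A : set V) : Prop :=
  [/\ gvset A, A !=set0 & gvultrafilter [set B | gvset B /\ A `<=` B]].

Definition infinite_emitter (A : set V) : Prop :=
  infinite_set [set e : E | A (esrc e)].

Definition chain (s : seq E) : bool :=
  sorted (fun e f => `[< erng e (esrc f) >]) s.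

(* Range of a finite path; the empty path imposes no restriction. *)
Definition srng (s : seq E) : set V :=
  if s is e :: s' then erng (last e s') else setT.

(* [UPath (edges := [::]) A] is the length-zero ultrapath [A]; the others are
   the pairs (alpha, A) with |alpha| >= 1. *)
Record upath := UPath {
  edges : seq E;
  urng : set V;
  edges_chain : chain edges;
  urng_gv : gvset urng;
  urng_neq0 : urng !=set0;
  urng_sub : urng `<=` srng edges }.

Definition ulen (x : upath) : nat := size (edges x).

Definition usrc (x : upath) : set V :=
  if edges x is e :: _ then [set esrc e] else urng x.

Record ipath := IPath {
  iedge : nat -> E;
  iedge_chain : forall n, erng (iedge n) (esrc (iedge n.+1)) }.

Definition isrc (g : ipath) : V := esrc (iedge g 0).

Inductive gpath := Fin of upath | Inf of ipath.

(* Graph of the partial product: [is_prod x m a] means that x . m is defined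
   and equal to a. *)
Definition is_prod (x : upath) (m a : gpath) : Prop :=
  match m, a with
  | Fin y, Fin z =>
      [/\ urng x `&` usrc y !=set0,
          edges z = edges x ++ edges y
        & urng z = if edges y is [::] then urng x `&` urng y else urng y]
  | Inf g, Inf d =>
      urng x (isrc g) /\
      forall n, iedge d n = nth (iedge g (n - ulen x)%N) (edges x) n
  | _, _ => False
  end.

Definition D_ (x : upath) : set gpath := [set a | exists m, is_prod x m a].

HB.instance Definition _ := gen_eqMixin gpath.
HB.instance Definition _ := gen_choiceMixin gpath.
HB.instance Definition _ := @isSubBaseTopological.Build gpath (set gpath)
  [set B | exists x, B = D_ x \/ B = ~` D_ x] id.

Definition Y_infty : set upath :=
  [set y | ultraset (urng y) /\ infinite_emitter (urng y)].

Definition unit_set : set gpath :=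
  [set a | if a is Fin y then Y_infty y else True].

(* The library equips the type of elements of a set with the subspace
   topology. *)
Definition unit_space : topologicalType := set_type unit_set.

Record ugpd := UGpd {
  ug_rng : unit_space;
  ug_deg : int;
  ug_src : unit_space;
  ug_spec : exists x y m,
    [/\ urng x = urng y, is_prod x m (val ug_rng), is_prod y m (val ug_src)
      & ug_deg = (ulen x)%:Z - (ulen y)%:Z] }.

Definition ubasic (x y : upath) (U : set unit_space) : set ugpd :=
  [set g | exists m,
    [/\ is_prod x m (val (ug_rng g)), is_prod y m (val (ug_src g)),
        ug_deg g = (ulen x)%:Z - (ulen y)%:Z & U (ug_rng g)]].

(* Proved to be a base, not merely a subbase, in [ubase_cover], [ubase_join]. *)
Definition ubase : set (set ugpd) :=
  [set B | exists x y U,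
    [/\ urng x = urng y, open U & B = ubasic x y U]].

Lemma upath_eq (x y : upath) : edges x = edges y -> urng x = urng y -> x = y.
Proof.
case: x y => [s A a1 a2 a3 a4] [t B b1 b2 b3 b4] /= ? ?; subst.
by f_equal; exact: Prop_irrelevance.
Qed.

Lemma ugpd_eq (g h : ugpd) : ug_rng g = ug_rng h -> ug_deg g = ug_deg h ->
  ug_src g = ug_src h -> g = h.
Proof.
case: g h => [a m b p] [c n d q] /= ? ? ?; subst.
by f_equal; exact: Prop_irrelevance.
Qed.

Lemma srng_cat s t : t != [::] -> srng (s ++ t) = srng t.
Proof. by case: s => [//|e s]; case: t => // f t _ /=; rewrite last_cat. Qed.

Lemma chain_cat s t : chain (s ++ t) <->
  [/\ chain s, chain t & if t is f :: _ then srng s (esrc f) else True].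
Proof.
case: s => [|e s] /=; first by case: t => [|f t]; split => // -[].
rewrite /chain /= cat_path; case: t => [|f t] /=.
  by rewrite andbT; split => [|[]].
split; first by move=> /and3P[? /asboolP ? ?].
by move=> [-> -> h]; rewrite andbT /=; apply/asboolP.
Qed.

Definition starts (A : set V) (t : seq E) : Prop :=
  if t is f :: _ then A (esrc f) else True.

(* [fits A t C]: the tail (t, C) may be appended to an ultrapath of range A. *)
Definition fits (A : set V) (t : seq E) (C : set V) : Prop :=
  if t is f :: _ then A (esrc f) else C `<=` A.

Definition linked (x y : upath) (a b : gpath) : Prop :=
  match a, b with
  | Fin a, Fin b => exists t,
      [/\ edges a = edges x ++ t, edges b = edges y ++ t, urng a = urng b
        & fits (urng x) t (urng a)]
  | Inf a, Inf b => exists g : ipath,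
      [/\ urng x (isrc g),
        (forall n, iedge a n = nth (iedge g (n - ulen x)%N) (edges x) n)
      & forall n, iedge b n = nth (iedge g (n - ulen y)%N) (edges y) n]
  | _, _ => False
  end.

Lemma linkedP x y a b : urng x = urng y ->
  linked x y a b <-> exists m, is_prod x m a /\ is_prod y m b.
Proof.
move=> rxy; case: a => a; case: b => b /=; [| | |].
- split => [[t [ea eb rab ft]]|]; last first.
    case=> -[m|m]; last by case.
    case=> -[h1 h2 h3] [h4 h5 h6].
    exists (edges m); split => //; first by rewrite h3 h6 rxy.
    rewrite h3; move: h1; rewrite /fits /usrc; case: (edges m) => [_|f s].
      exact: subIsetl.
    by case=> v [xv /= vf]; rewrite -vf.
  have ct : chain t by have := edges_chain a; rewrite ea => /chain_cat[].
  have st : urng a `<=` srng t.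
    case: t ea ft {eb ct} => [//|f t] ea _; have := @urng_sub a.
    by rewrite ea srng_cat.
  exists (Fin (UPath ct (urng_gv a) (@urng_neq0 a) st)) => /=.
  rewrite -rxy /usrc /= -rab; case: t ea eb ft {ct st} => [|f t] ea eb ft.
    by rewrite (setIidr ft); have := urng_neq0 a.
  by split; split => //; exists (esrc f).
- by split => // -[[m|m] []].
- by split => // -[[m|m] []].
- split => [[g [h1 h2 h3]]|]; first by exists (Inf g); rewrite /= -rxy.
  case=> -[m|g]; first by case.
  by case=> -[h1 h2] [h3 h4]; exists g.
Qed.

Lemma linked_sym x y a b : urng x = urng y -> linked x y a b -> linked y x b a.
Proof.
by move=> rxy /(linkedP _ _ rxy)[m [? ?]]; apply/linkedP => //; exists m.
Qed.

(* Appending to x the part t of z = y t, when x and y have the same range. *)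
Definition glue_rng (A B : set V) (t : seq E) : set V :=
  if t is [::] then A `&` B else B.

Lemma glue x y z t : urng x = urng y -> edges z = edges y ++ t ->
  glue_rng (urng y) (urng z) t !=set0 ->
  starts (urng y) t ->
  exists p, edges p = edges x ++ t /\ urng p = glue_rng (urng y) (urng z) t.
Proof.
move=> rxy ez h0 ht.
have c : chain (edges x ++ t).
  apply/chain_cat; have := edges_chain z; rewrite ez => /chain_cat[_ ct _].
  split => //; first exact: edges_chain.
  by case: (t) ht => // f t' yf; apply: urng_sub; rewrite rxy.
have g : gvset (glue_rng (urng y) (urng z) t).
  case: (t) => [|f t'] /=; last exact: urng_gv.
  by apply: gvsetI; exact: urng_gv.
have s : glue_rng (urng y) (urng z) t `<=` srng (edges x ++ t).
  clear c g h0 ht; case: t ez => [|f t] ez /=.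
    by rewrite cats0 -rxy => v [xv _]; exact: urng_sub.
  by rewrite srng_cat //; have := @urng_sub z; rewrite ez srng_cat.
by exists (UPath c g h0 s).
Qed.

Lemma ipath_prefix (y z : upath) (b g k : nat -> E) :
  (ulen y <= ulen z)%N ->
  (forall n, b n = nth (g (n - ulen y)%N) (edges y) n) ->
  (forall n, b n = nth (k (n - ulen z)%N) (edges z) n) ->
  exists t, [/\ edges z = edges y ++ t,
    (forall n, g n = nth (k (n - size t)%N) t n)
    & (if t is f :: _ then f = g 0%N else k 0%N = g 0%N)].
Proof.
move=> le hy hz; exists (drop (ulen y) (edges z)).
have tk : take (ulen y) (edges z) = edges y.
  apply: (@eq_from_nth _ (g 0%N)); first by rewrite size_takel.
  move=> i; rewrite size_takel // => iy; rewrite nth_take //.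
  have := hy i; rewrite hz => h.
  rewrite (set_nth_default (k (i - ulen z)%N)); last by rewrite (leq_trans iy).
  by rewrite h; exact: set_nth_default.
have eg n : g n = nth (k (n - size (drop (ulen y) (edges z)))%N)
                      (drop (ulen y) (edges z)) n.
  have := hy (ulen y + n)%N; rewrite nth_default ?leq_addr // addKn hz => <-.
  rewrite nth_drop size_drop; congr nth; congr k.
  by rewrite -/(ulen z); lia.
split => //; first by rewrite -{1}tk cat_take_drop.
have := eg 0%N; case: (drop _ _) => [|f t] /=; first by rewrite subn0.
by move->.
Qed.

Lemma fin_prefix (s t u v : seq E) : (size s <= size t)%N ->
  s ++ u = t ++ v -> exists w, t = s ++ w /\ u = w ++ v.
Proof.
move=> le eq; exists (drop (size s) t).
have tk : take (size s) t = s.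
  have := congr1 (take (size s)) eq.
  by rewrite take_size_cat // takel_cat.
have et : t = s ++ drop (size s) t by rewrite -{1}tk cat_take_drop.
split => //; move: eq; rewrite {1}et -catA => /eqP.
by rewrite eqseq_cat // eqxx => /eqP.
Qed.

(* Common refinement of two factorizations of the same element. *)
Lemma refine (x y z w : upath) (a b c : gpath) :
  urng x = urng y -> urng z = urng w -> (ulen y <= ulen z)%N ->
  linked x y a b -> linked z w b c ->
  exists t, [/\ edges z = edges y ++ t,
    starts (urng y) t,
    glue_rng (urng y) (urng z) t !=set0 &
    forall p q, edges p = edges x ++ t -> edges q = edges w ->
      urng p = glue_rng (urng y) (urng z) t ->
      linked p q a c].
Proof.
move=> rxy rzw le; case: a => a; case: b => b //; case: c => c //=.
- move=> [u [ea eb rab fu]] [v [eb' ec rbc fv]].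
  have [t [ez eu]] := fin_prefix le (etrans (esym eb) eb').
  exists t; have n0 := urng_neq0 b; rewrite rab rxy in fu.
  have key : fits (glue_rng (urng y) (urng z) t) v (urng b).
    move: fu fv; rewrite eu; case: (t) => [|f t']; case: v {eb' ec eu} => //=.
      by move=> *; rewrite subsetI.
  split => //.
  + by move: fu; rewrite eu; case: (t).
  + move: key; case: v {eb' ec fv eu} => [|f v] /= h; last by exists (esrc f).
    by case: n0 => w0 /h; exists w0.
  + move=> p q ep eq rp; exists v; rewrite ep eq ea eu catA rp rab.
    by split.
- move=> [g [xg ha hb]] [k [zk hb' hc]].
  have [t [ez eg ht]] := ipath_prefix le hb hb'; exists t.
  have yt : starts (urng y) t.
    by rewrite -rxy; move: ht; rewrite /starts; case: (t) => // f t' ->.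
  have gk : glue_rng (urng y) (urng z) t (isrc k).
    move: ht; rewrite /glue_rng; case: (t) => [hk|//]; split => //.
    by rewrite /isrc hk -rxy.
  split; [exact: ez | exact: yt | by exists (isrc k) |].
  move=> p q ep eq rp; exists k; rewrite rp; split => //; last first.
    by move=> n; rewrite hc /ulen eq.
  move=> n; rewrite ha /ulen ep nth_cat size_cat; case: ltnP => nx.
    exact: set_nth_default.
  by rewrite nth_default // eg subnDA.
Qed.

Definition ug_linked (a : unit_space) (m : int) (b : unit_space) : Prop :=
  exists x y n, [/\ urng x = urng y, is_prod x n (val a), is_prod y n (val b)
    & m = (ulen x)%:Z - (ulen y)%:Z].

Lemma ug_linkedP a m b : ug_linked a m b <-> exists x y,
  [/\ urng x = urng y, linked x y (val a) (val b)
    & m = (ulen x)%:Z - (ulen y)%:Z].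
Proof.
split=> [[x [y [n [r p q e]]]]|[x [y [r l e]]]].
  by exists x, y; split => //; apply/linkedP => //; exists n.
by have /(linkedP _ _ r)[n [? ?]] := l; exists x, y, n.
Qed.

Lemma ug_linkedV a m b : ug_linked a m b -> ug_linked b (- m) a.
Proof.
by move=> [x [y [n [r p q e]]]]; exists y, x, n; split => //; rewrite e opprB.
Qed.

Lemma ug_linkedM a m b n c : ug_linked a m b -> ug_linked b n c ->
  ug_linked a (m + n) c.
Proof.
have main (a' b' c' : unit_space) x y z w : urng x = urng y -> urng z = urng w ->
    (ulen y <= ulen z)%N ->
    linked x y (val a') (val b') -> linked z w (val b') (val c') ->
    ug_linked a' ((ulen x)%:Z - (ulen y)%:Z + ((ulen z)%:Z - (ulen w)%:Z)) c'.
  move=> rxy rzw le l1 l2; have [t [ez ht n0 H]] := refine rxy rzw le l1 l2.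
  have [p [ep rp]] := glue rxy ez n0 ht.
  have ewz : edges w = edges w ++ [::] by rewrite cats0.
  have rglue : glue_rng (urng y) (urng z) t `<=` urng z.
    by move=> v; rewrite /glue_rng; case: (t) => [[]|].
  have [q [eq rq]] : exists q, edges q = edges w /\ urng q = urng p.
    have gp : urng p `<=` srng (edges w).
      by rewrite rp => v /rglue; rewrite rzw; exact: urng_sub.
    by exists (UPath (edges_chain w) (urng_gv p) (@urng_neq0 p) gp).
  apply/ug_linkedP; exists p, q; split; [by rewrite rq | exact: H |].
  by rewrite /ulen ep eq ez !size_cat; lia.
move=> /ug_linkedP[x [y [rxy lxy ->]]] /ug_linkedP[z [w [rzw lzw ->]]].
have [le|/ltnW le] := leqP (ulen y) (ulen z); first exact: (main a b c x y z w rxy rzw le).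
have := main c b a w z y x (esym rzw) (esym rxy) le.
move=> /(_ (linked_sym rzw lzw) (linked_sym rxy lxy)) /ug_linkedV.
by congr ug_linked; lia.
Qed.

Lemma linked_refl x y a b : linked x y a b -> linked x x a a.
Proof.
case: a b => a [] b //=; first by move=> [t [? _ _ ?]]; exists t.
by move=> [g [? ? _]]; exists g.
Qed.

Lemma linked_edges x y p t a : edges p = edges y ++ t -> ulen p = ulen x ->
  linked p x a a -> edges x = edges p.
Proof.
move=> _ exy; case: a => a /=.
  by move=> [v [-> /eqP]]; rewrite eqseq_cat // => /andP[/eqP-> _].
move=> [g [_ h1 h2]]; apply: (@eq_from_nth _ (iedge g 0)); first by rewrite -/(ulen x) -exy.
move=> i ix; have := h1 i; rewrite h2 => h.
rewrite (set_nth_default (iedge g (i - ulen x)%N)) // h.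
by apply: set_nth_default; rewrite -/(ulen p) exy.
Qed.

Lemma linked_weaken x y p q t a b :
  edges p = edges x ++ t -> edges q = edges y ++ t ->
  starts (urng x) t -> (t = [::] -> urng p `<=` urng x) ->
  linked p q a b -> linked x y a b.
Proof.
move=> ep eq st s0; case: a b => a [] b //=.
  move=> [v [ea eb rab fv]]; exists (t ++ v); rewrite ea eb ep eq -!catA.
  split => //; case: (t) st s0 => [_ /(_ erefl) px|//] /=.
  by move: fv; case: (v) => [|f v'] /= h; [exact: subset_trans h px|exact: px].
move=> [g [pg ha hb]].
pose k n := nth (iedge g (n - size t)%N) t n.
have kc n : erng (k n) (esrc (k n.+1)).
  have /= := iedge_chain a (n + ulen x)%N; rewrite -addSn !ha /ulen ep.
  by rewrite !nth_cat ![(_ + size _ < _)%N]ltnNge !leq_addl /= !addnK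
    size_cat ![(size _ + size t)%N]addnC !subnDr.
exists (IPath kc); split.
- rewrite /isrc /= /k; move: st s0 pg; case: (t) => [_ /(_ erefl) px|//].
  by move=> /px; rewrite /= subn0.
- move=> n; rewrite ha /ulen ep nth_cat size_cat /= /k subnDA.
  case: ltnP => nx; first exact: set_nth_default.
  by rewrite [RHS]nth_default.
- move=> n; rewrite hb /ulen eq nth_cat size_cat /= /k subnDA.
  case: ltnP => nx; first exact: set_nth_default.
  by rewrite [RHS]nth_default.
Qed.

Lemma ubasicP x y U : urng x = urng y -> ubasic x y U = [set g |
  [/\ linked x y (val (ug_rng g)) (val (ug_src g)),
      ug_deg g = (ulen x)%:Z - (ulen y)%:Z & U (ug_rng g)]].
Proof.
move=> r; apply/seteqP; split => g /=.
  by move=> [m [? ? ? ?]]; split => //; apply/linkedP => //; exists m.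
by move=> [/(linkedP _ _ r)[m [? ?]] ? ?]; exists m.
Qed.

Lemma ubase_join B1 B2 g : ubase B1 -> ubase B2 -> B1 g -> B2 g ->
  exists B, [/\ ubase B, B g & B `<=` B1 `&` B2].
Proof.
have main x y U x' y' U' : urng x = urng y -> urng x' = urng y' ->
    open U -> open U' -> ubasic x y U g -> ubasic x' y' U' g ->
    (ulen x <= ulen x')%N ->
    exists B, [/\ ubase B, B g & B `<=` ubasic x y U `&` ubasic x' y' U'].
  move=> r r' oU oU'; rewrite !ubasicP // => -[l d Ug] [l' d' Ug'] le.
  have [t [ez st n0 H]] := refine (esym r) r' le (linked_sym r l) l'.
  have [t' [ez' st' n0' H']] := refine erefl r' le (linked_refl l) l'.
  have tt : t' = t.
    by move/eqP: ez'; rewrite ez eqseq_cat // eqxx => /eqP.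
  subst t'.
  have [p [ep rp]] := glue erefl ez n0 st.
  have [q [eq rq]] := glue (esym r) ez n0 st.
  have eqy : edges y' = edges q.
    apply: (linked_edges eq _ (H _ _ eq erefl rq)).
    by move: d d'; rewrite /ulen eq ez !size_cat => ->; lia.
  have lpq : linked p q (val (ug_rng g)) (val (ug_src g)).
    have := H' p y' ep erefl rp.
    move: (val (ug_rng g)) (val (ug_src g)) => [a|a] [b|b] //=.
      by rewrite eqy.
    by rewrite /ulen eqy.
  have dpq : (ulen p)%:Z - (ulen q)%:Z = (ulen x')%:Z - (ulen y')%:Z.
    by rewrite /ulen ep -ez -eqy.
  exists (ubasic p q (U `&` U')); split.
  - by exists p, q, (U `&` U'); split => //; [rewrite rp rq | exact: openI].
  - by rewrite ubasicP ?rp ?rq //; split => //; rewrite dpq.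
  - rewrite ubasicP ?rp ?rq // => h [lh dh [Uh U'h]]; split.
      split => //; last by rewrite dh dpq -d' d.
      apply: (linked_weaken ep eq st _ lh) => t0.
      by rewrite rp t0; exact: subIsetl.
    split => //; last by rewrite dh dpq.
    apply: (@linked_weaken _ _ p q [::]) lh => //; rewrite ?cats0 //.
      by rewrite ep ez.
    by move=> _ v; rewrite rp; case: (t) => [[]|].
move=> [x [y [U [r oU ->]]]] [x' [y' [U' [r' oU' ->]]]] h h'.
have [le|/ltnW le] := leqP (ulen x) (ulen x'); first exact: main.
by have [B [? ? BI]] := main _ _ _ _ _ _ r' r oU' oU h' h le;
  exists B; split => //; rewrite setIC.
Qed.

Lemma ubase_cover : \bigcup_(B in ubase) B = setT.
Proof.
apply/seteqP; split => // g _; have [x [y [m [r p q e]]]] := ug_spec g.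
exists (ubasic x y setT); last by exists m.
by exists x, y, setT; split => //; exact: openT.
Qed.

HB.instance Definition _ := gen_eqMixin ugpd.
HB.instance Definition _ := gen_choiceMixin ugpd.
HB.instance Definition _ :=
  @isBaseTopological.Build ugpd (set ugpd) ubase id ubase_cover
    (fun B1 B2 g b1 b2 => @ubase_join B1 B2 g b1 b2).

Lemma ug_idP (a : unit_space) : ug_linked a 0 a.
Proof.
have mk (A : set V) : gvset A -> A !=set0 ->
    exists x, edges x = [::] /\ urng x = A.
  by move=> gA nA; exists (UPath (edges := [::]) isT gA nA (fun _ _ => I)).
case E0 : (val a) => [u|g].
- have [x [ex rx]] : exists x, edges x = [::] /\ urng x = usrc u.
    apply: mk; rewrite /usrc; case: (edges u) => [|e s].
    + exact: urng_gv.
    + exact: gvset1.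
    + exact: urng_neq0.
    + by exists (esrc e).
  exists x, x, (Fin u); rewrite subrr E0.
  suff H : is_prod x (Fin u) (Fin u) by [].
  rewrite /= rx setIid ex; split => //.
    by rewrite /usrc; case: (edges u) => [|e s];
      [exact: urng_neq0 | exists (esrc e)].
  by rewrite /usrc; case: (edges u) => //; rewrite setIid.
- have [x [ex rx]] := mk _ (gvset1 (isrc g)) (ex_intro _ (isrc g) erefl).
  exists x, x, (Inf g); rewrite subrr E0.
  suff H : is_prod x (Inf g) (Inf g) by [].
  by rewrite /= rx /ulen ex; split => // n; rewrite nth_nil subn0.
Qed.

Definition ug_id (a : unit_space) : ugpd := UGpd (ug_idP a).

Definition ug_inv (g : ugpd) : ugpd := UGpd (ug_linkedV (ug_spec g)).

Lemma ug_mulP (g h : ugpd) : ug_src g = ug_rng h ->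
  ug_linked (ug_rng g) (ug_deg g + ug_deg h) (ug_src h).
Proof.
move=> e; apply: (ug_linkedM (ug_spec g)).
by rewrite e; exact: ug_spec.
Qed.

Definition ug_mul (g h : ugpd) : ugpd :=
  if pselect (ug_src g = ug_rng h) is left e then UGpd (ug_mulP e) else g.

Lemma ug_mulE (g h : ugpd) : ug_src g = ug_rng h ->
  [/\ ug_rng (ug_mul g h) = ug_rng g,
      ug_deg (ug_mul g h) = ug_deg g + ug_deg h
    & ug_src (ug_mul g h) = ug_src h].
Proof. by move=> e; rewrite /ug_mul; case: pselect. Qed.

End Ultrapaths.

(* A groupoid with a topology on its arrows and on its unit space. The product
   [gmul g h] is meaningful only when [gsrc g = grng h]. *)
Record groupoid := Groupoid {
  arrow : topologicalType;
  object : topologicalType;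
  grng : arrow -> object;
  gsrc : arrow -> object;
  gid : object -> arrow;
  ginv : arrow -> arrow;
  gmul : arrow -> arrow -> arrow;
  grng_id : forall u, grng (gid u) = u;
  gsrc_id : forall u, gsrc (gid u) = u;
  grng_inv : forall g, grng (ginv g) = gsrc g;
  gsrc_inv : forall g, gsrc (ginv g) = grng g;
  grng_mul : forall g h, gsrc g = grng h -> grng (gmul g h) = grng g;
  gsrc_mul : forall g h, gsrc g = grng h -> gsrc (gmul g h) = gsrc h;
  gmulA : forall g h k, gsrc g = grng h -> gsrc h = grng k ->
    gmul g (gmul h k) = gmul (gmul g h) k;
  gmul1g : forall g, gmul (gid (grng g)) g = g;
  gmulg1 : forall g, gmul g (gid (gsrc g)) = g;
  gmulVg : forall g, gmul (ginv g) g = gid (gsrc g);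
  gmulgV : forall g, gmul g (ginv g) = gid (grng g) }.

Section UltrapathGroupoid.
Variable G : ultragraph.
Implicit Types g h k : ugpd G.

Fact ug_rng_mul g h : ug_src g = ug_rng h -> ug_rng (ug_mul g h) = ug_rng g.
Proof. by move=> /ug_mulE[]. Qed.

Fact ug_src_mul g h : ug_src g = ug_rng h -> ug_src (ug_mul g h) = ug_src h.
Proof. by move=> /ug_mulE[]. Qed.

Fact ug_mulA g h k : ug_src g = ug_rng h -> ug_src h = ug_rng k ->
  ug_mul g (ug_mul h k) = ug_mul (ug_mul g h) k.
Proof.
move=> gh hk; have [r1 d1 s1] := ug_mulE gh; have [r2 d2 s2] := ug_mulE hk.
have [|r3 d3 s3] := @ug_mulE _ g (ug_mul h k); first by rewrite r2.
have [|r4 d4 s4] := @ug_mulE _ (ug_mul g h) k; first by rewrite s1.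
by apply: ugpd_eq; rewrite ?r3 ?r4 ?s3 ?s4 ?d3 ?d4 // d1 d2 addrA.
Qed.

Fact ug_mul1g g : ug_mul (ug_id (ug_rng g)) g = g.
Proof.
have [|r d s] := @ug_mulE _ (ug_id (ug_rng g)) g; first by [].
by apply: ugpd_eq; rewrite ?r ?s ?d //= add0r.
Qed.

Fact ug_mulg1 g : ug_mul g (ug_id (ug_src g)) = g.
Proof.
have [|r d s] := @ug_mulE _ g (ug_id (ug_src g)); first by [].
by apply: ugpd_eq; rewrite ?r ?s ?d //= addr0.
Qed.

Fact ug_mulVg g : ug_mul (ug_inv g) g = ug_id (ug_src g).
Proof.
have [|r d s] := @ug_mulE _ (ug_inv g) g; first by [].
by apply: ugpd_eq; rewrite ?r ?s ?d //= addNr.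
Qed.

Fact ug_mulgV g : ug_mul g (ug_inv g) = ug_id (ug_rng g).
Proof.
have [|r d s] := @ug_mulE _ g (ug_inv g); first by [].
by apply: ugpd_eq; rewrite ?r ?s ?d //= subrr.
Qed.

Definition ultrapath_groupoid : groupoid :=
  @Groupoid (ugpd G) (unit_space G) (@ug_rng G) (@ug_src G) (@ug_id G)
    (@ug_inv G) (@ug_mul G) (fun=> erefl) (fun=> erefl) (fun=> erefl)
    (fun=> erefl) ug_rng_mul ug_src_mul ug_mulA ug_mul1g ug_mulg1 ug_mulVg
    ug_mulgV.

End UltrapathGroupoid.

Section Amenability.
Variables (R : realType) (G : groupoid).
Local Notation C := (R[i] : numClosedFieldType).

Definition supp (f : arrow G -> C) : set (arrow G) :=
  closure [set g | f g != 0].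

(* Renault defines amenability for locally compact groupoids, by means of nets
   in C_c(G). When G is locally compact and its unit space is Hausdorff, [Cc f]
   says exactly that f belongs to C_c(G): the second condition then follows
   from the third. The ultrapath groupoid need not be locally compact: if the
   edges are e_n (n : nat), with source n and range all of nat, then ultrasets
   are singletons, the unit space is the Baire space nat -> nat, and 0 is the
   only continuous compactly supported function on the groupoid. When local
   compactness fails, the support is only required to be proper over the unit
   space. *)
Definition Cc (f : arrow G -> C) : Prop :=
  [/\ continuous f,
      forall K : set (object G), compact K ->
        compact (supp f `&` @grng G @^-1` K)
    & locally_compact [set: arrow G] -> compact (supp f)].

Definition directed (I : Type) (le : I -> I -> Prop) : Prop :=
  [/\ inhabited I, forall i, le i i,
      forall i j k, le i j -> le j k -> le i k
    & forall i j, exists k, le i k /\ le j k].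

(* Integral for the counting measure on the fibre of grng over u. The finitely
   supported sum suffices: fibres of an r-discrete groupoid are discrete, so a
   function satisfying [Cc] has finite support on each of them. *)
Definition fibre_sum (u : object G) (F : arrow G -> C) : C :=
  \sum_(h \in [set h | grng h = u]) F h.

(* Renault, A groupoid approach to C*-algebras, section II.3, for an r-discrete
   groupoid with counting measures: the fibre norms of the f_i are uniformly
   bounded and f_i * f_i^* tends to 1 uniformly on compact sets; the convolution
   is written h |-> f (g h) * conj (f h), summed over range h = source g. *)
Definition amenable : Prop :=
  exists (I : Type) (le : I -> I -> Prop) (f : I -> arrow G -> C),
  [/\ directed le,
      forall i, Cc (f i),
      exists M : R, forall i u, fibre_sum u (fun h => `|f i h| ^+ 2) <= M%:C%C
    & forall K : set (arrow G), compact K -> forall e : R, 0 < e ->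
        exists i0, forall i, le i0 i -> forall g, K g ->
          `|fibre_sum (gsrc g) (fun h => f i (gmul g h) * (f i h)^*) - 1|
            < e%:C%C].

End Amenability.

(* Main.v *)
(* The approximate invariant means are built from the shift. Fix a finite set
   F_N of edges and an integer n. From a in the unit space X, walk along the
   arrows (a, k, sigma^k a) for k < n, stopping as soon as a ends or its next edge
   is not in F_N, and let m_a be the distribution of the position at a uniformly
   chosen time. Stopping outside the finite set F_N makes m_a locally constant in
   a, although finite ultrapaths are limits of longer ones. If the finite paths
   x and y have all their edges in F_N, translating m_(y mu) by
   (x mu, |x| - |y|, y mu) gives m_(x mu) up to a mass of
   max(|x|, |y|) / n. The functions f are the square roots of the densities of m,
   multiplied by the indicator of a clopen set of units; that set is compact when
   the groupoid is locally compact. *)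

Require Import Defs.
From HB Require Import structures.
From mathcomp Require Import all_boot all_order all_algebra.
From mathcomp Require Import all_classical all_reals all_analysis.
From mathcomp.real_closed Require Import complex.
From mathcomp Require Import finmap zify lra.

Set Implicit Arguments.
Unset Strict Implicit.
Unset Printing Implicit Defensive.
Import Order.TTheory GRing.Theory Num.Theory.
Import numFieldNormedType.Exports.
Local Open Scope classical_set_scope.
Local Open Scope ring_scope.

(** * Letter-by-letter description of ultrapaths and of their factorizations *)

Section Paths.
Variable G : ultragraph.
Local Notation V := (vertex G).
Local Notation E := (edge G).

(** Finite and infinite paths are treated alike through their letters [gnth] and their final set
    [gend], which determine the path by [gpath_eq]. *)
Definition gnth (a : gpath G) (n : nat) : option E :=
  match a with Fin u => onth (edges u) n | Inf g => Some (iedge g n) end.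

Definition gend (a : gpath G) : option (set V) :=
  if a is Fin u then Some (urng u) else None.

(* The source of the n-fold shift of a, provided n is at most the length of a. *)
Definition gsource (a : gpath G) (n : nat) : set V :=
  if gnth a n is Some e then [set esrc e] else odflt set0 (gend a).

Definition gprefix (s : seq E) (a : gpath G) : Prop :=
  forall i, (i < size s)%N -> gnth a i = onth s i.

(** By [D_E] these include all the sets [D_ x]. The word need not be a path, and [A = setT] leaves a
    bare prefix condition. *)
Definition cyl (s : seq E) (A : set V) : set (gpath G) :=
  [set a | gprefix s a /\ gsource a (size s) `<=` A].

Lemma gpath_eq a b : (forall i, gnth a i = gnth b i) -> gend a = gend b ->
  a = b.
Proof.
case: a => [u|g]; case: b => [v|h] //= en.
  by move=> -[er]; congr Fin; apply: upath_eq => //; exact: eq_from_onth.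
move=> _; congr Inf; case: g h en => [g gc] [h hc] /= en.
have {}en : g = h by apply/funext => i; have [] := en i.
by subst h; f_equal; exact: Prop_irrelevance.
Qed.

Lemma gsource_neq0 a n : gsource a n !=set0.
Proof.
rewrite /gsource; case an: (gnth a n) => [e|] /=; first by exists (esrc e).
by case: a an => [u|g] //= _; have := urng_neq0 u.
Qed.

Lemma gsource_gv a n : gvset (gsource a n).
Proof.
rewrite /gsource; case an: (gnth a n) => [e|] /=; first exact: gvset1.
by case: a an => [u|g] //= _; exact: urng_gv.
Qed.

Lemma onth_drop (T : Type) k (s : seq T) i :
  onth (drop k s) i = onth s (k + i)%N.
Proof. by rewrite !onthE map_drop nth_drop. Qed.

Lemma onth_take (T : Type) k (s : seq T) i :
  onth (take k s) i = if (i < k)%N then onth s i else None.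
Proof.
rewrite !onthE map_take; case: ltnP => ik; first by rewrite nth_take.
by rewrite nth_default // size_take_min geq_min ik.
Qed.

Lemma onth_nthE (T : Type) (x : T) s i : (i < size s)%N ->
  onth s i = Some (nth x s i).
Proof. by move=> h; rewrite onthE (nth_map x). Qed.

Lemma gprefix_fin s u : gprefix s (Fin u) ->
  edges u = s ++ drop (size s) (edges u).
Proof.
move=> h; apply: eq_from_onth => i; rewrite onth_cat onth_drop.
by case: ltnP => [/h //|?]; rewrite subnKC.
Qed.

Lemma gprefix_inf s g : gprefix s (Inf g) <->
  forall n, iedge g n = nth (iedge g n) s n.
Proof.
split=> h n.
  case: (ltnP n (size s)) => ns; last by rewrite nth_default.
  by have := h n ns; rewrite /= (onth_nthE (iedge g n)) // => -[].
by move=> ns; rewrite /= (onth_nthE (iedge g n)) // -h.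
Qed.

Lemma gprefix_chain s a : gprefix s a ->
  chain s /\ (s != [::] -> gsource a (size s) `<=` srng s).
Proof.
case: a => [u|g] h.
  have eu := gprefix_fin h; have := edges_chain u; rewrite {1}eu.
  move=> /chain_cat[cs ct st]; split => // s0.
  rewrite /gsource /= -[size s]addn0 -onth_drop.
  case ed : (drop _ _) st eu => [|e t] /=; last by move=> ? _ v ->.
  by rewrite cats0 => _ <-; exact: urng_sub.
have key k : gsource (Inf g) k.+1 `<=` erng (iedge g k).
  by rewrite /gsource /= => v ->; exact: iedge_chain.
have es : s = mkseq (iedge g) (size s).
  apply: (@eq_from_nth _ (iedge g 0%N)); first by rewrite size_mkseq.
  move=> i si.
  rewrite nth_mkseq // [RHS](iffLR (gprefix_inf _ _) h); exact: set_nth_default.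
split; last first.
  rewrite es; case: (size s) => // n _; rewrite size_mkseq /=.
  have -> : last (iedge g 0) [seq iedge g i | i <- iota 1 n] = iedge g n.
    by case: n => // n; rewrite -[X in iota _ X]addn1 iotaD map_cat last_cat /= add1n.
  exact: key.
rewrite es /chain /mkseq; elim: (size s) 0%N => //= n IH k.
have := IH k.+1; case: (n) => //= m ->; rewrite andbT.
by apply/asboolP; exact: iedge_chain.
Qed.

(** The common tail is recovered from a by dropping the letters of x, so the existential in [linked]
    can be traded for conditions on letters. *)
Lemma linkedE x y a b : urng x = urng y -> linked x y a b <->
  [/\ cyl (edges x) (urng x) a, cyl (edges y) (urng y) b,
      forall i, gnth a (ulen x + i) = gnth b (ulen y + i)
    & gend a = gend b].
Proof.
move=> rxy; split.
- have pre (z : upath G) t c : edges c = edges z ++ t -> gprefix (edges z) (Fin c).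
    by move=> ec i iz /=; rewrite ec onth_cat iz.
  have tl (z : upath G) t c i : edges c = edges z ++ t ->
      gnth (Fin c) (ulen z + i) = onth t i.
    by move=> ec /=; rewrite ec onth_cat ltnNge leq_addr /= addKn.
  case: a b => a [] b //=.
    move=> [t [ea eb rab ft]].
    have src (z : upath G) c : edges c = edges z ++ t ->
        fits (urng z) t (urng c) -> gsource (Fin c) (size (edges z)) `<=` urng z.
      move=> ec; rewrite /gsource -[size _]addn0 (tl z t) //.
      by case: (t) => [|f t'] //= zf v ->.
    split; last by rewrite rab.
    + by split; [exact: pre ea|exact: src].
    + by split; [exact: pre eb|apply: src => //; rewrite -rxy -rab].
    + by move=> i; have := tl _ _ _ i ea; have := tl _ _ _ i eb => /= -> ->.
  move=> [g [xg ha hb]].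
  have cy (z : upath G) c :
      (forall n, iedge c n = nth (iedge g (n - ulen z)) (edges z) n) ->
     urng z (isrc g) ->
     cyl (edges z) (urng z) (Inf c).
    move=> hc zg; split; last first.
      by move=> v; rewrite /gsource /= hc nth_default // subnn => ->.
    by apply/gprefix_inf => n; rewrite hc; case: (ltnP n (ulen z)) => nz;
      [exact: set_nth_default|rewrite !(nth_default _ nz)].
  split => //; first exact: cy.
    by apply: cy; rewrite -?rxy.
  by move=> i; rewrite ha hb !nth_default ?leq_addr // !addKn.
- case: a b => a [] b [[pa sa] [pb sb] /= ht he] //.
    exists (drop (ulen x) (edges a)).
    have ea := gprefix_fin pa; have eb := gprefix_fin pb.
    have dE : drop (ulen x) (edges a) = drop (ulen y) (edges b).
      by apply: eq_from_onth => i; rewrite !onth_drop ht.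
    split => //; [by rewrite dE|by case: he|].
    move: sa; rewrite /gsource /= -[size _]addn0 -onth_drop /ulen.
    by case: (drop _ _) => [|f t] //=; apply.
  have kc n : erng (iedge a (ulen x + n)) (esrc (iedge a (ulen x + n.+1))).
    by rewrite addnS; exact: iedge_chain.
  exists (IPath kc); split.
  + by apply: sa; rewrite /gsource /isrc /= addn0.
  + move=> n /=; case: (ltnP n (ulen x)) => nx.
      by rewrite (iffLR (gprefix_inf _ _) pa); exact: set_nth_default.
    by rewrite nth_default // subnKC.
  + move=> n /=; case: (ltnP n (ulen y)) => ny.
      by rewrite (iffLR (gprefix_inf _ _) pb); exact: set_nth_default.
    by rewrite nth_default //; have [->] := ht (n - ulen y)%N; rewrite subnKC.
Qed.

Lemma D_E x : D_ x = cyl (edges x) (urng x).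
Proof.
apply/seteqP; split => a.
  move=> [m xm]; have /(linkedE _ _ erefl)[//] : linked x x a a.
  by apply/linkedP => //; exists m.
move=> xa; have /linkedP [|m []] // : linked x x a a; last by exists m.
exact/linkedE.
Qed.

End Paths.

(** * Clopen sets of paths and units, basic open sets of arrows *)

Section GpathTopology.
Variable G : ultragraph.

Definition gsubbase : set (set (gpath G)) :=
  [set B | exists x, B = D_ x \/ B = ~` D_ x].

Lemma gopenE : @open (gpath G) =
  [set \bigcup_(B in D') B | D' in subset^~ (finI_from gsubbase id)].
Proof. by []. Qed.

Lemma D_clopen (x : upath G) : clopen (D_ x).
Proof.
have op (B : set (gpath G)) : (B = D_ x \/ B = ~` D_ x) -> open B.
  move=> Bx; rewrite gopenE /=; exists [set B]; last by rewrite bigcup_set1.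
  by move=> _ ->; apply: finI_from1; exists x.
by split; [exact/op/or_introl|rewrite -openC; apply/op; right].
Qed.

Lemma gsubbase_clopen B : gsubbase B -> clopen B.
Proof.
move=> [x [->|->]]; first exact: D_clopen.
exact/clopenC/D_clopen.
Qed.

Lemma gopen_finI (O : set (gpath G)) a : open O -> O a ->
  exists2 B : {fset set (gpath G)}, {subset B <= gsubbase} &
    (\bigcap_(C in [set` B]) C) a /\ \bigcap_(C in [set` B]) C `<=` O.
Proof.
rewrite gopenE => -[D' sD' <-] [C D'C Ca].
have [B sB CE] := sD' _ D'C; exists B => //.
have {}CE : \bigcap_(C in [set` B]) C = C by [].
by rewrite CE; split => // b Cb; exists C.
Qed.

Lemma continuous_gpath (T : topologicalType) (f : T -> gpath G) :
  (forall x, clopen (f @^-1` D_ x)) -> continuous f.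
Proof.
move=> fD a O; rewrite nbhsE => -[Q [oQ Qa]] /filterS; apply.
have [B sB [Ba BO]] := gopen_finI oQ Qa.
have fBO : f @^-1` (\bigcap_(C in [set` B]) C) `<=` f @^-1` Q by move=> b /BO.
apply: (filterS fBO); rewrite preimage_bigcap; apply: filter_bigI => C CB.
have [x Cx] := set_mem (sB C CB); apply: open_nbhs_nbhs; split; last exact: (Ba C).
have [oD cD] := fD x; case: Cx => ->; first exact: oD.
by rewrite preimage_setC openC.
Qed.

(** A nonempty cylinder is the whole space or [D_ x], where x has edges [s] and range [A] cut down
    to the range of [s]. *)
Lemma cyl_clopen s (A : set (vertex G)) : gvset A \/ A = setT -> clopen (cyl s A).
Proof.
move=> Ag; have [[a0 sa0]|nE] := pselect (exists a, cyl s A a); last first.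
  rewrite (_ : cyl s A = set0); first exact: clopen0.
  by apply/seteqP; split => // a sa; apply: nE; exists a.
have [cs ss] := gprefix_chain sa0.1.
(* This case is apart because [srng [::]] is [setT], which need not be in [gvset]. *)
have [[s0 AT]|sA] := pselect (s = [::] /\ A = setT).
  rewrite (_ : cyl s A = setT); first exact: clopenT.
  by apply/seteqP; split => // a _; rewrite s0 AT; split.
have gB : gvset (A `&` srng s).
  case: Ag => [gA|AT].
    by case: (s) => [|e t]; rewrite ?setIT //; apply: gvsetI => //; exact: gvset_rng.
  by rewrite AT setTI; case: (s) sA => [[]//|e t] _; exact: gvset_rng.
have sub a : cyl s A a -> gsource a (size s) `<=` A `&` srng s.
  move=> [pa sa]; rewrite subsetI; split => //.
  have [_] := gprefix_chain pa; case: (s) => //= e t; exact.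
have n0 : A `&` srng s !=set0.
  by have [v /(sub _ sa0)] := gsource_neq0 a0 (size s); exists v.
rewrite (_ : cyl s A = D_ (UPath cs gB n0 (@subIsetr _ _ _))).
  exact: D_clopen.
rewrite D_E /=; apply/seteqP; split => a [pa sa]; split => //.
  exact: sub.
by apply: subset_trans sa _; exact: subIsetl.
Qed.

Lemma unit_clopen_basis (O : set (unit_space G)) a : open O -> O a ->
  exists W, [/\ clopen W, W a & W `<=` O].
Proof.
move=> [Q oQ <-] Qa; have [B sB [Ba BO]] := gopen_finI oQ Qa.
exists (set_val @^-1` \bigcap_(C in [set` B]) C); split => //; last first.
  by move=> b /BO.
apply: preimage_clopen; last exact: initial_continuous.
split.
  rewrite gopenE; exists [set \bigcap_(C in [set` B]) C].
    by move=> _ ->; exists B.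
  by rewrite bigcup_set1.
apply: closed_bigI => C CB.
by have /set_mem/gsubbase_clopen[] := sB C CB.
Qed.

Lemma ucyl_clopen s (A : set (vertex G)) : gvset A \/ A = setT ->
  clopen [set a : unit_space G | cyl s A (val a)].
Proof.
move=> Ag; apply: (@preimage_clopen (unit_space G) _ set_val (cyl s A)).
  exact: cyl_clopen.
exact: initial_continuous.
Qed.

Lemma uopenE : @open (ugpd G) =
  [set \bigcup_(B in D') B | D' in subset^~ (@ubase G)].
Proof. by []. Qed.

Lemma ubasic_open (x y : upath G) U : urng x = urng y -> open U ->
  open (ubasic x y U).
Proof.
move=> rxy oU; rewrite uopenE; exists [set ubasic x y U].
  by move=> _ ->; exists x, y, U.
by rewrite bigcup_set1.
Qed.

Lemma ubasic_basis (O : set (ugpd G)) g : open O -> O g ->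
  exists x y U, [/\ urng x = urng y, open U, ubasic x y U g
                  & ubasic x y U `<=` O].
Proof.
rewrite uopenE => -[D' sD' <-] [B D'B Bg].
have [x [y [U [rxy oU BE]]]] := sD' _ D'B.
by exists x, y, U; rewrite -BE; split => // h Bh; exists B.
Qed.

Lemma ubasicE (x y : upath G) U g : urng x = urng y -> ubasic x y U g <->
  [/\ [/\ cyl (edges x) (urng x) (val (ug_rng g)),
      cyl (edges y) (urng y) (val (ug_src g)),
      forall i, gnth (val (ug_rng g)) (ulen x + i)
              = gnth (val (ug_src g)) (ulen y + i)
    & gend (val (ug_rng g)) = gend (val (ug_src g))],
    ug_deg g = (ulen x)%:Z - (ulen y)%:Z & U (ug_rng g)].
Proof. by move=> r; rewrite ubasicP //=; split=> -[/(linkedE _ _ r)]. Qed.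

Lemma ugpd_ubasic (g : ugpd G) : exists x y,
  urng x = urng y /\ forall U : set (unit_space G), U (ug_rng g) -> ubasic x y U g.
Proof.
have [x [y [m [r p q e]]]] := ug_spec g; exists x, y; split => // U Ug.
by exists m.
Qed.

Lemma ug_rng_continuous : continuous (@ug_rng G).
Proof.
apply/continuousP => U oU; rewrite openE => g Ug.
have [x [y [rxy /(_ _ Ug) gxy]]] := ugpd_ubasic g.
apply: filterS (open_nbhs_nbhs (conj (ubasic_open rxy oU) gxy)).
by move=> h [m []].
Qed.

End GpathTopology.

Lemma locally_constant_clopen (T : topologicalType) (P : set T) :
  (forall g, exists2 O, open O /\ O g & forall h, O h -> (P h <-> P g)) -> clopen P.
Proof.
move=> lc; split; last rewrite -openC; rewrite openE => g Pg.
  have [Q gQ QP] := lc g; apply: filterS (open_nbhs_nbhs gQ).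
  by move=> h /QP/iffRL; apply.
have [Q gQ QP] := lc g; apply: filterS (open_nbhs_nbhs gQ).
by move=> h /QP/iffLR/contra_not; apply.
Qed.

Lemma clopen_bigsetU (T : topologicalType) n (F : nat -> set T) :
  (forall i, clopen (F i)) -> clopen (\bigcup_(i in `I_n) F i).
Proof.
move=> cF; rewrite bigcup_mkord.
by elim/big_ind : _ => //; [exact: clopen0|exact: clopenU].
Qed.

(** * The source map, and the arrows (a, k, sigma^k a) of the shift *)

Section Arrows.
Variable G : ultragraph.
Implicit Types (g h : ugpd G) (a b : unit_space G) (x y z : upath G).

Lemma gsource_shift (a b : gpath G) m n : gnth a m = gnth b n ->
  gend a = gend b -> gsource a m = gsource b n.
Proof. by rewrite /gsource => -> ->. Qed.

Lemma ug_gend g : gend (val (ug_rng g)) = gend (val (ug_src g)).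
Proof.
have [x [y [rxy /(_ setT I) /(ubasicE _ _ rxy)]]] := ugpd_ubasic g.
by case=> -[].
Qed.

(** Basic sets restrict the range only, but on [ubasic x y setT] the range x mu determines the
    source y mu. Membership of y mu in [D_ z] thus becomes a clopen condition W on x mu. *)
Lemma ug_src_continuous : continuous (@ug_src G).
Proof.
apply: (@continuous_comp_initial _ _ _ (@set_val _ (@unit_set G))).
apply: continuous_gpath => z.
apply: locally_constant_clopen => g.
have [x [y [rxy gxy]]] := ugpd_ubasic g.
suff [W cW WP] : exists2 W : set (unit_space G), clopen W &
    forall h, ubasic x y setT h -> D_ z (val (ug_src h)) <-> W (ug_rng h).
  have gT := gxy setT I.
  have [Wg|nWg] := pselect (W (ug_rng g)).
    exists (ubasic x y W); first by split; [exact: ubasic_open rxy cW.1|exact: gxy].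
    move=> h [m [? ? ? Wh]]; have hT : ubasic x y setT h by exists m.
    by split=> _; [exact: iffRL (WP g gT) Wg|exact: iffRL (WP h hT) Wh].
  exists (ubasic x y (~` W)).
    by split; [apply: ubasic_open rxy _; rewrite openC; exact: cW.2|exact: gxy].
  move=> h [m [? ? ? Wh]]; have hT : ubasic x y setT h by exists m.
  by split=> [/(iffLR (WP h hT))|/(iffLR (WP g gT))].
(* If z is shorter than y, the condition involves only y and z, so W is everything or nothing. *)
have [zy|yz] := ltnP (ulen z) (ulen y).
  pose P := (forall i, (i < ulen z)%N -> onth (edges y) i = onth (edges z) i) /\
    forall e, onth (edges y) (ulen z) = Some e -> urng z (esrc e).
  exists [set _ | P].
    have [p|np] := pselect P.
      by rewrite (_ : mkset _ = setT); [exact: clopenT|apply/seteqP; split].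
    by rewrite (_ : mkset _ = set0); [exact: clopen0|apply/seteqP; split].
  move=> h /(ubasicE _ _ rxy)[[_ [py _] _ _] _ _]; rewrite D_E /cyl /= /P.
  rewrite /gprefix /gsource -/(ulen z) py //.
  have [e ye] : exists e, onth (edges y) (ulen z) = Some e.
    by have := onthTE (edges y) (ulen z); rewrite zy; case: onth => // e; exists e.
  rewrite ye; split => -[pz sz]; split => //.
  - by move=> i iz; rewrite -py ?pz //; exact: ltn_trans zy.
  - by move=> _ [<-]; exact: sz.
  - by move=> i iz; rewrite py ?pz //; exact: ltn_trans zy.
  - by move=> v ->; exact: sz.
(* Otherwise W is empty unless y is a prefix of z, and then it is the cylinder of x followed by the
   rest of z. *)
have [yzE|nyz] := pselect (forall i, (i < ulen y)%N ->
    onth (edges y) i = onth (edges z) i); last first.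
  exists set0; first exact: clopen0.
  move=> h /(ubasicE _ _ rxy)[[_ [py _] _ _] _ _]; split => //.
  rewrite D_E => -[pz _]; apply: nyz => i iy.
  by rewrite -py // pz //; exact: leq_trans yz.
exists [set a : unit_space G |
    cyl (edges x ++ drop (ulen y) (edges z)) (urng z) (val a)].
  by apply: ucyl_clopen; left; exact: urng_gv.
move=> h /(ubasicE _ _ rxy)[[[px _] [py _] t ge] _ _]; rewrite D_E /cyl /=.
have -> : gsource (val (ug_rng h)) (size (edges x ++ drop (ulen y) (edges z))) =
    gsource (val (ug_src h)) (ulen z).
  apply: gsource_shift => //; rewrite size_cat size_drop.
  by rewrite t subnKC.
split => -[pz sz]; split => // i.
  rewrite size_cat size_drop onth_cat onth_drop => iz.
  case: ltnP => ix; first exact: px.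
  have := t (i - ulen x)%N; rewrite (subnKC ix) => ->; apply: pz.
  by move: iz ix yz; rewrite /ulen; lia.
move=> iz; have [iy|yi] := ltnP i (ulen y); first by rewrite py // yzE.
have := t (i - ulen y)%N; rewrite (subnKC yi) => <-.
rewrite pz ?size_cat ?size_drop ?onth_cat ?onth_drop.
  by rewrite ltnNge leq_addr addKn subnKC.
by move: iz yi yz; rewrite /ulen; lia.
Qed.

(** Final sets are not compared: by [ug_gend] they agree on every arrow. *)
Definition is_shift (k : nat) : set (ugpd G) := [set g |
  ug_deg g = k%:Z /\
  forall i, gnth (val (ug_src g)) i = gnth (val (ug_rng g)) (k + i)].

(** On [ubasic x y setT] the degree is constant and the tails already agree, so only finitely many
    letters of x and y remain to be compared. *)
Lemma is_shift_clopen k : clopen (is_shift k).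
Proof.
apply: locally_constant_clopen => g.
have [x [y [rxy gxy]]] := ugpd_ubasic g.
exists (ubasic x y setT); first by split; [exact: ubasic_open rxy openT|exact: gxy].
have key h : ubasic x y setT h -> is_shift k h <->
    (ulen x)%:Z - (ulen y)%:Z = k%:Z /\
    forall i, (i < ulen y)%N -> onth (edges y) i = onth (edges x) (k + i).
  move=> /(ubasicE _ _ rxy)[[[px _] [py _] t ge] dh _].
  rewrite /is_shift /= dh; split => -[dk sh]; split => // i.
    move=> iy; rewrite -py // sh px //; move: dk iy; rewrite /ulen; lia.
  have [iy|yi] := ltnP i (ulen y).
    rewrite py // sh // px //; move: dk iy; rewrite /ulen; lia.
  have := t (i - ulen y)%N; rewrite (subnKC yi) => <-; congr gnth.
  by move: dk yi; rewrite /ulen; lia.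
move=> h hxy; apply: (iff_trans (key h hxy)); apply: iff_sym; apply: key.
exact: gxy.
Qed.

Lemma is_shift_inj k g h : is_shift k g -> is_shift k h ->
  ug_rng g = ug_rng h -> g = h.
Proof.
move=> [dg sg] [dh sh] gh; apply: ugpd_eq => //; first by rewrite dg.
apply/val_inj/gpath_eq; last by rewrite -!ug_gend gh.
by move=> i; rewrite sg sh gh.
Qed.

Lemma is_shift_id a : is_shift 0 (ug_id a).
Proof. by []. Qed.

Lemma is_shift_ex (a : unit_space G) k :
  (forall i, (i < k)%N -> gnth (val a) i) ->
  exists2 g, ug_rng g = a & is_shift k g.
Proof.
move=> ak.
have [s sk sa] : exists2 s, size s = k & gprefix s (val a).
  case: (val a) ak => [u|g] ak /=.
    exists (take k (edges u)).
      rewrite size_takel //; case: k ak => // k /(_ k (ltnSn _)) /=.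
      by rewrite onthTE.
    by move=> i; rewrite size_take_min leq_min => /andP[ik _] /=; rewrite onth_take ik.
  exists (mkseq (iedge g) k); first by rewrite size_mkseq.
  by apply/gprefix_inf => n; case: (ltnP n k) => nk;
    [rewrite nth_mkseq|rewrite nth_default // size_mkseq].
(* Dropping k letters keeps the final set, so the tail stays in the unit space. *)
have [b [bU bs be]] : exists b : gpath G, [/\ unit_set b,
    forall i, gnth b i = gnth (val a) (k + i) & gend b = gend (val a)].
  have aU : unit_set (val a) := set_valP a.
  case: (val a) sa aU => [u|g] sa aU.
    have eu := gprefix_fin sa.
    have ce : chain (drop k (edges u)).
      by have := edges_chain u; rewrite {1}eu sk => /chain_cat[].
    have su : urng u `<=` srng (drop k (edges u)).
      have [->|d0] := eqVneq (drop k (edges u)) [::]; first exact: subsetT.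
      by have := @urng_sub _ u; rewrite {1}eu sk srng_cat.
    exists (Fin (UPath ce (urng_gv u) (@urng_neq0 _ u) su)).
    by split; [exact: aU|by move=> i; rewrite /= onth_drop|by []].
  have kc n : erng (iedge g (k + n)) (esrc (iedge g (k + n.+1))).
    by rewrite addnS; exact: iedge_chain.
  by exists (Inf (IPath kc)); split.
have [cs ss] := gprefix_chain sa; rewrite sk in ss.
have s1 : gsource (val a) k `<=` srng s.
  by have [->|/ss] := eqVneq s [::]; first exact: subsetT.
(* With the source of the tail as common range, a = x b and b = y b. *)
pose x := UPath cs (gsource_gv (val a) k) (gsource_neq0 _ _) s1.
pose y := UPath (edges := [::]) isT (gsource_gv (val a) k) (gsource_neq0 _ _)
  (fun _ _ => I).
pose b' : unit_space G := SigSub (mem_set bU).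
have l : ug_linked a k%:Z b'.
  apply/ug_linkedP; exists x, y; split => //; last by rewrite /ulen /= sk subr0.
  apply/linkedE => //; split => //=; last by move=> i; rewrite /ulen /= sk bs.
    by split; rewrite ?sk.
  split => //; rewrite (@gsource_shift _ (val a) _ k) //.
  by rewrite bs addn0.
exists (UGpd l) => //; split => //= i; exact: bs.
Qed.

(** F_N consists of the edges of [pickle] code below N; from these units the walk can make k
    steps. *)
Definition Om (N k : nat) : set (unit_space G) := [set a |
  forall i, (i < k)%N -> exists2 e, gnth (val a) i = Some e & (choice.pickle e < N)%N].

(** Since F_N is finite, this is a finite union of cylinders. *)
Lemma Om_clopen N k : clopen (Om N k).
Proof.
(* For the induction on k, the steps are counted after a prescribed prefix s. *)
pose Q s k : set (unit_space G) := [set a | gprefix s (val a) /\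
  forall i, (i < k)%N ->
    exists2 e, gnth (val a) (size s + i) = Some e & (choice.pickle e < N)%N].
suff Qc s : clopen (Q s k).
  have := Qc [::]; congr clopen; apply/seteqP; split => a; first by case.
  by split.
elim: k s => [|k IH] s.
  rewrite (_ : Q s 0%N = [set a | cyl s setT (val a)]).
    by apply: ucyl_clopen; right.
  by apply/seteqP; split => a [pa _]; split.
rewrite (_ : Q s k.+1 = \bigcup_(j in `I_N)
    if @choice.pickle_inv (edge G) j is Some e then Q (rcons s e) k else set0).
  apply: clopen_bigsetU => j.
  by case: choice.pickle_inv => [e|]; [exact: IH|exact: clopen0].
apply/seteqP; split => a /=.
  move=> [pa ka]; have [e] := ka 0%N isT; rewrite addn0 => ae eN.
  exists (choice.pickle e) => //=; rewrite choice.pickleK_inv; split.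
    move=> i; rewrite size_rcons ltnS leq_eqVlt => /orP[/eqP->|si].
      by rewrite ae -cats1 onth_cat ltnn subnn.
    by rewrite pa // -cats1 onth_cat si.
  by move=> i ik; rewrite size_rcons addSnnS; exact: ka.
move=> [j /= jN]; case ej : (choice.pickle_inv j) => [e|//] [pa ka].
have ae : gnth (val a) (size s) = Some e.
  by rewrite pa ?size_rcons // -cats1 onth_cat ltnn subnn.
split.
  move=> i si; rewrite pa ?size_rcons -?cats1 ?onth_cat ?si //.
  exact: ltnW.
move=> [|i] ik; last by rewrite -addSnnS -(size_rcons s e); exact: ka.
exists e; first by rewrite addn0.
by have := @choice.pickle_invK (edge G) j; rewrite ej /= => ->.
Qed.

Lemma Om_le N N' k k' : (N <= N')%N -> (k' <= k)%N -> Om N k `<=` Om N' k'.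
Proof.
move=> NN kk a ak i ik; have [e ae eN] := ak i (leq_trans ik kk).
by exists e => //; exact: leq_trans NN.
Qed.

Lemma Om_shift_ex N k a : Om N k a -> exists2 g, ug_rng g = a & is_shift k g.
Proof. by move=> ak; apply: is_shift_ex => i /ak[e ->]. Qed.

(* The continuous local inverse of the range map on the arrows (a, k, sigma^k a),
   extended by units off the clopen set Om N k. *)
Definition sec N k a : ugpd G :=
  if pselect (Om N k a) is left h then s2val (cid2 (Om_shift_ex h)) else ug_id a.

Lemma sec_rng N k a : ug_rng (sec N k a) = a.
Proof. by rewrite /sec; case: pselect => // h; case: cid2. Qed.

Lemma secP N k a : Om N k a -> is_shift k (sec N k a).
Proof. by rewrite /sec; case: pselect => // h _; case: cid2. Qed.

Lemma sec_continuous N k : continuous (sec N k).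
Proof.
move=> a O; rewrite nbhsE => -[Q [oQ Qa] QO].
suff aQ : nbhs a (sec N k @^-1` Q) by apply: filterS aQ => b /QO.
have [x [y [U [rxy oU axy UQ]]]] := ubasic_basis oQ Qa.
(* Near a the section shifts by a fixed number c: k on [Om N k] and 0 on its complement, both of
   which are open. *)
suff H (c : nat) (C : set (unit_space G)) : open C -> C a ->
    (forall b, C b -> is_shift c (sec N k b)) -> nbhs a (sec N k @^-1` Q).
  have [aO|naO] := pselect (Om N k a).
    by apply: (H k (Om N k)) => //; [exact: (Om_clopen N k).1|exact: secP].
  apply: (H 0%N (~` Om N k)) => //; first by rewrite openC; exact: (Om_clopen N k).2.
  by move=> b nb; rewrite /sec; case: pselect => // ?; exact: is_shift_id.
move=> oC Ca cC.
have := axy => /(ubasicE _ _ rxy)[[ax [py _] _ _]]; rewrite !sec_rng in ax *.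
have [-> sh] := cC a Ca => dk Ua.
have D_o : open [set b : unit_space G | cyl (edges x) (urng x) (val b)].
  by apply: (ucyl_clopen _ _).1; left; exact: urng_gv.
apply: filterS (open_nbhs_nbhs (conj (openI oC (openI D_o oU)) _)); last by split.
move=> b [Cb [/= [px bx] Ub]]; apply: UQ; apply/ubasicE => //; rewrite !sec_rng.
(* As |x| = c + |y|, the conditions of y on the source are those of x on b, shifted by c letters. *)
have [db sb] := cC b Cb; have xE : (ulen x = c + ulen y)%N by lia.
split; [split|by rewrite db|by []] => //.
- split.
    move=> i iy; rewrite sb sec_rng px -?py //; last by rewrite -/(ulen x) xE ltn_add2l.
    rewrite sh sec_rng; apply/esym/(ax.1); by rewrite -/(ulen x) xE ltn_add2l.
  rewrite -(@gsource_shift (val b) _ (ulen x)) -?rxy //.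
    by rewrite sb sec_rng xE.
  by rewrite -ug_gend sec_rng.
- by move=> i; rewrite sb sec_rng xE addnA.
- by rewrite -ug_gend sec_rng.
Qed.

End Arrows.

Arguments is_shift {G} k _.
Arguments Om {G} N k _.

(* P k says that the walk can make k steps; the total mass m is spent one unit
   per step, and what remains is left at the last position. *)
Lemma telescope_weights (P : nat -> bool) m : P 0%N ->
  (forall k, P k.+1 -> P k) ->
  (\sum_(k < m | P k) (if P k.+1 then 1 else m - k) = m)%N.
Proof.
move=> P0 PS.
suff H j : (j <= m)%N -> (\sum_(k < j | P k) (if P k.+1 then 1 else m - k) =
    if P j then j else m)%N.
  by rewrite H //; case: ifP.
elim: j => [|j IH] jm; first by rewrite big_ord0 P0.
rewrite big_mkcond big_ord_recr -big_mkcond /= IH 1?ltnW //.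
have := PS j; case: (P j.+1) => [->//|_]; first by rewrite addn1.
by case: (P j); rewrite ?addn0 // subnKC // ltnW.
Qed.

Lemma clopen_near (T : topologicalType) (P : set T) (g : T) : clopen P ->
  \forall h \near g, P h = P g.
Proof.
move=> [oP cP]; have [Pg|nPg] := pselect (P g).
  apply: filterS (open_nbhs_nbhs (conj oP Pg)) => h Ph.
  by apply/propext.
apply: filterS (@open_nbhs_nbhs _ g (~` P) _) => [h nPh|].
  by apply/propext.
by split => //; rewrite openC.
Qed.

(** * Weights of the stopped walk and the functions built from them *)

Section Functions.
Variables (R : realType) (G : ultragraph).
Implicit Types (g h : ugpd G) (a b : unit_space G) (x y z : upath G).

Lemma ug_deg_near g : \forall h \near g, ug_deg h = ug_deg g.
Proof.
have [x [y [rxy /(_ setT I) gxy]]] := ugpd_ubasic g.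
apply: filterS (open_nbhs_nbhs (conj (ubasic_open rxy openT) gxy)).
by case: gxy => [m [_ _ -> _]] h [m' [_ _ -> _]].
Qed.

(** For a in [Om N k]: the k-th position counts for one of the n times if a further step is
    possible; otherwise the walk stays there for the n - k remaining times. *)
Definition wt (N n k : nat) a : R :=
  if (k < n)%N then (if `[< Om N k.+1 a >] then 1 else n - k)%N%:R / n%:R
  else 0.

(* The square root of the density at g of the law of the stopped walk from the
   range of g. *)
Definition fwt (N n : nat) (C : set (unit_space G)) g : R :=
  let k := `|ug_deg g|%N in
  if `[< [/\ C (ug_rng g), is_shift k g & Om N k (ug_rng g)] >]
  then Num.sqrt (wt N n k (ug_rng g)) else 0.

Lemma wt_ge0 N n k a : 0 <= wt N n k a.
Proof. by rewrite /wt; case: ifP => // _; rewrite divr_ge0. Qed.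

Lemma fwt_ge0 N n C g : 0 <= fwt N n C g.
Proof. by rewrite /fwt; case: ifP => // _; exact: sqrtr_ge0. Qed.

Lemma fwtE N n (C : set (unit_space G)) k g : is_shift k g -> C (ug_rng g) ->
  Om N k (ug_rng g) -> fwt N n C g = Num.sqrt (wt N n k (ug_rng g)).
Proof.
move=> gk Cg kg; have ek : `|ug_deg g|%N = k by rewrite gk.1.
by rewrite /fwt ek asboolT.
Qed.

Lemma fwt_neq0 N n (C : set (unit_space G)) g : fwt N n C g != 0 ->
  exists k, [/\ (k < n)%N, C (ug_rng g), is_shift k g & Om N k (ug_rng g)].
Proof.
rewrite /fwt; case: asboolP => [[Cg kg ag]|_]; last by rewrite eqxx.
rewrite /wt; case: ltnP => [kn _|]; last by rewrite sqrtr0 eqxx.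
by exists `|ug_deg g|%N.
Qed.

(** The value depends only on the locally constant degree and on clopen conditions. *)
Lemma fwt_near N n C g : clopen C -> \forall h \near g, fwt N n C h = fwt N n C g.
Proof.
move=> cC; set k := `|ug_deg g|%N.
have rc (D : set (unit_space G)) : clopen D ->
    \forall h \near g, D (ug_rng h) = D (ug_rng g).
  move=> cD; apply: (@clopen_near _ (@ug_rng G @^-1` D)).
  by apply: preimage_clopen => //; exact: ug_rng_continuous.
have n1 := ug_deg_near g; have n2 := rc _ cC; have n3 := rc _ (Om_clopen G N k).
have n4 := rc _ (Om_clopen G N k.+1); have n5 := clopen_near g (@is_shift_clopen G k).
near=> h.
have e1 : ug_deg h = ug_deg g by near: h.
have e2 : C (ug_rng h) = C (ug_rng g) by near: h.
have e3 : Om N k (ug_rng h) = Om N k (ug_rng g) by near: h.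
have e4 : Om N k.+1 (ug_rng h) = Om N k.+1 (ug_rng g) by near: h.
have e5 : is_shift k h = is_shift k g by near: h.
by rewrite /fwt e1 -/k e2 e3 e5 /wt e4.
Unshelve. all: by end_near. Qed.

Lemma asbool_Om0 N a : `[< Om N 0 a >].
Proof. by apply/asboolP. Qed.

Lemma asbool_OmS N k a : `[< Om N k.+1 a >] -> `[< Om N k a >].
Proof. by move=> /asboolP ak; apply/asboolP; exact: Om_le ak. Qed.

Lemma wt_sum N n a : (0 < n)%N -> \sum_(k < n | `[< Om N k a >]) wt N n k a = 1.
Proof.
move=> n0; have n0R : n%:R != 0 :> R by rewrite pnatr_eq0 -lt0n.
rewrite (eq_bigr (fun k : 'I_n =>
  (if `[< Om N k.+1 a >] then 1 else n - k)%N%:R / n%:R)); last first.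
  by move=> k _; rewrite /wt ltn_ord.
rewrite -mulr_suml -natr_sum.
rewrite (@telescope_weights (fun k => `[< Om N k a >]) n) ?divff //.
  exact: asbool_Om0.
by move=> k; exact: asbool_OmS.
Qed.

(** In the fibre over b, a function supported on shift arrows lives on the points [sec N k b], which
    are distinct because their degrees are. *)
Lemma fibre_sum_sec (F : ugpd G -> R[i]) N n b :
  (forall h, ug_rng h = b -> F h != 0 ->
     exists k, [/\ (k < n)%N, is_shift k h & Om N k b]) ->
  @fibre_sum R (ultrapath_groupoid G) b F =
  \sum_(k < n | `[< Om N k b >]) F (sec N k b).
Proof.
move=> Fs.
pose P := [set k : 'I_n | Om N k b].
have inj : set_inj P (fun k : 'I_n => sec N k b).
  move=> k l /set_mem Pk /set_mem Pl kl; apply: val_inj.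
  have := (secP Pk).1; rewrite kl (secP Pl).1; by case.
rewrite /fibre_sum.
rewrite -(@fsbig_widen _ _ _ _ [set sec N k b | k in P]); last 2 first.
- by move=> h [k _ <-]; rewrite /= sec_rng.
- move=> h [hb nh]; apply: contrapT => /eqP Fh; apply: nh.
  have [k [kn hk bk]] := Fs h hb Fh; exists (Ordinal kn) => //=.
  by apply: (is_shift_inj (secP bk) hk); rewrite sec_rng.
rewrite fsbig_image // [RHS]bigfs ?index_enum_uniq //; last first.
  by move=> k _; rewrite mem_index_enum.
by apply: eq_fsbigl; apply/seteqP; split => k /asboolP.
Qed.

Lemma ler_sqrt_mul (m p q : R) : 0 <= m -> m <= p -> m <= q ->
  m <= Num.sqrt p * Num.sqrt q.
Proof.
move=> m0 mp mq; rewrite -{1}(sqr_sqrtr m0) expr2.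
by apply: ler_pM; rewrite ?sqrtr_ge0 ?ler_wsqrtr.
Qed.

End Functions.

(** * Upper and lower bounds for the overlap with a translate *)

Section Overlap.
Variables (R : realType) (G : ultragraph).
Implicit Types (g h : ugpd G) (a b : unit_space G) (x y z : upath G).

Lemma fwt_sec N n (C : set (unit_space G)) k b : Om N k b -> C b ->
  fwt R N n C (sec N k b) = Num.sqrt (wt R N n k b).
Proof.
by move=> bk Cb; rewrite (fwtE R n (secP bk)) sec_rng.
Qed.

Lemma fwt_norm N n (C : set (unit_space G)) b : (0 < n)%N ->
  \sum_(k < n | `[< Om N k b >]) fwt R N n C (sec N k b) ^+ 2 <= 1.
Proof.
move=> n0; rewrite -(wt_sum R N b n0); apply: ler_sum => k /asboolP bk.
have [Cb|nCb] := pselect (C b); first by rewrite fwt_sec // sqr_sqrtr ?wt_ge0.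
suff -> : fwt R N n C (sec N k b) = 0 by rewrite expr0n wt_ge0.
apply: contra_notP nCb => /eqP/fwt_neq0[l [_ + _ _]].
by rewrite sec_rng.
Qed.

(** Translation by g is injective and moves the index k to deg g + k, so the sum is at most the
    total mass of the walk from the range of g. *)
Lemma fwt_translate_norm N n (C : set (unit_space G)) g : (0 < n)%N ->
  \sum_(k < n | `[< Om N k (ug_src g) >])
    fwt R N n C (ug_mul g (sec N k (ug_src g))) ^+ 2 <= 1.
Proof.
move=> n0; rewrite -(wt_sum R N (ug_rng g) n0).
(* Each l is matched with at most one k, which bounds the double sum once its order is exchanged. *)
pose c (k l : 'I_n) := (ug_deg g + k%:Z == l%:Z).
apply: (@le_trans _ _ (\sum_(k < n | `[< Om N k (ug_src g) >])
    \sum_(l < n | `[< Om N l (ug_rng g) >])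
      if c k l then wt R N n l (ug_rng g) else 0)).
  apply: ler_sum => k /asboolP bk; set h := ug_mul _ _.
  have [hr hd hs] := @ug_mulE _ g (sec N k (ug_src g)) (esym (sec_rng _ _ _)).
  have [->|/fwt_neq0[l [ln Cl hl al]]] := eqVneq (fwt R N n C h) 0.
    rewrite expr0n; apply: sumr_ge0 => l _; case: ifP => // _; exact: wt_ge0.
  rewrite (fwtE R n hl) // sqr_sqrtr ?wt_ge0 // hr.
  rewrite hr in al.
  rewrite (bigD1 (Ordinal ln)) /=; last exact/asboolP.
  have -> : c k (Ordinal ln).
    by rewrite /c /= -hl.1 hd (secP bk).1.
  rewrite lerDl; apply: sumr_ge0 => j _; case: ifP => // _; exact: wt_ge0.
rewrite exchange_big /=; apply: ler_sum => l al.
rewrite -big_mkcondr /= sumr_const -[leRHS]mulr1n.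
rewrite ler_wpMn2l ?wt_ge0 //.
apply/card_le1_eqP => k1 k2.
rewrite /c => /andP[_ /eqP e1] /andP[_ /eqP e2].
by apply: val_inj; move: e1; rewrite -e2 => /addrI[].
Qed.

(** Both factors have square sum at most 1, and u v is at most the mean of u^2 and v^2. *)
Lemma overlap_le N n (C : set (unit_space G)) g : (0 < n)%N ->
  \sum_(k < n | `[< Om N k (ug_src g) >])
    fwt R N n C (ug_mul g (sec N k (ug_src g))) *
    fwt R N n C (sec N k (ug_src g)) <= 1.
Proof.
move=> n0.
have amgm (u v : R) : u * v <= 2^-1 * (u ^+ 2 + v ^+ 2).
  have := sqr_ge0 (u - v); rewrite sqrrB; lra.
apply: le_trans (ler_sum _ (fun k _ => amgm _ _)) _.
rewrite -mulr_sumr big_split /=.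
have := fwt_translate_norm N C g n0; have := fwt_norm N C (ug_src g) n0.
move: (\sum_(k < n | _) fwt R N n C (sec _ _ _) ^+ 2) => s.
move: (\sum_(k < n | _) _) => t; lra.
Qed.

(** All letters of x and y lie in F_N, so stopping is decided by the common tail. *)
Lemma Om_transfer N x y g t : urng x = urng y -> ubasic x y setT g ->
  all (fun e => choice.pickle e < N)%N (edges x) ->
  all (fun e => choice.pickle e < N)%N (edges y) ->
  Om N (ulen x + t) (ug_rng g) <-> Om N (ulen y + t) (ug_src g).
Proof.
move=> rxy /(ubasicE _ _ rxy)[[[px _] [py _] sh _] _ _] xN yN.
have small s (c : gpath G) i : all (fun e => choice.pickle e < N)%N s ->
    gprefix s c -> (i < size s)%N ->
    exists2 e, gnth c i = Some e & (choice.pickle e < N)%N.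
  move=> sN sc si; have := onthTE s i; rewrite si.
  case se : (onth s i) => [e|//] _; exists e; first by rewrite sc.
  by apply: (allP sN); apply/onthP; exists i.
split=> tN i ilt.
  have [iy|yi] := ltnP i (ulen y); first exact: small yN py iy.
  have := sh (i - ulen y)%N; rewrite (subnKC yi) => <-; apply: tN; lia.
have [ix|xi] := ltnP i (ulen x); first exact: small xN px ix.
have := sh (i - ulen x)%N; rewrite (subnKC xi) => ->; apply: tN; lia.
Qed.

(** From x mu and y mu, the walks reach the same point after |x| + t and |y| + t steps. Both masses
    there dominate that of the walk along mu with total mass m / n. *)
Lemma overlap_ge N n (C : set (unit_space G)) x y g : (0 < n)%N ->
  urng x = urng y -> ubasic x y setT g ->
  all (fun e => choice.pickle e < N)%N (edges x) ->
  all (fun e => choice.pickle e < N)%N (edges y) ->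
  C (ug_rng g) -> C (ug_src g) ->
  (n - maxn (ulen x) (ulen y))%N%:R / n%:R <=
  \sum_(k < n | `[< Om N k (ug_src g) >])
    fwt R N n C (ug_mul g (sec N k (ug_src g))) *
    fwt R N n C (sec N k (ug_src g)).
Proof.
move=> n0 rxy gxy xN yN Ca Cb; set m := (n - _)%N.
have mx : (m <= n - ulen x)%N by exact: leq_sub2l (leq_maxl _ _).
have my : (m <= n - ulen y)%N by exact: leq_sub2l (leq_maxr _ _).
set a := ug_rng g in Ca *; set b := ug_src g in Cb *.
pose F k := fwt R N n C (ug_mul g (sec N k b)) * fwt R N n C (sec N k b).
have F0 k : 0 <= F k by rewrite mulr_ge0 ?fwt_ge0.
pose P t := `[< Om N (ulen y + t) b >].
have PS t : P t.+1 -> P t by rewrite /P addnS; exact: asbool_OmS.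
have P0 : P 0%N.
  apply/asboolP; apply/(Om_transfer _ rxy gxy xN yN) => i; rewrite addn0 => ix.
  have := gxy => /(ubasicE _ _ rxy)[[[px _] _ _ _] _ _].
  have := onthTE (edges x) i; rewrite ix; case xe : (onth _ i) => [e|//] _.
  exists e; first by rewrite px.
  by apply: (allP xN); apply/onthP; exists i.
(* This spreads m / n over the times t of the walk along the common tail. *)
rewrite -{1}(telescope_weights m P0 PS) natr_sum mulr_suml.
apply: (@le_trans _ _ (\sum_(t < m | P t) F (ulen y + t)%N)).
  apply: ler_sum => t Pt; have /asboolP bt := Pt; have tm := ltn_ord t.
  have ke : (ulen y + t < n)%N by lia.
  have ka : (ulen x + t < n)%N by lia.
  have aT : Om N (ulen x + t) a by apply/(Om_transfer _ rxy gxy xN yN).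
  have [hr hd hs] := @ug_mulE _ g (sec N (ulen y + t) b) (esym (sec_rng _ _ _)).
  have [sd ss] := secP bt.
  have sh : is_shift (ulen x + t) (ug_mul g (sec N (ulen y + t) b)).
    have := gxy => /(ubasicE _ _ rxy)[[_ _ tl _] dg _].
    split; first by rewrite hd dg sd; lia.
    by move=> i; rewrite hs hr ss sec_rng -!addnA tl.
  rewrite /F (fwt_sec n bt Cb) (fwtE R n sh) ?hr //.
  have PE : `[< Om N (ulen x + t).+1 a >] = P t.+1.
    by rewrite -addnS; apply: asbool_equiv_eq; exact: (Om_transfer t.+1 rxy gxy xN yN).
  apply: ler_sqrt_mul; first by rewrite divr_ge0.
    rewrite /wt ka PE ler_pM2r ?invr_gt0 ?ltr0n // ler_nat; case: ifP => // _.
    by lia.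
  rewrite /wt ke -addnS -/(P t.+1) ler_pM2r ?invr_gt0 ?ltr0n // ler_nat.
  by case: ifP => // _; lia.
(* For m > 0 the truncated subtraction is exact, so |y| + m <= n and the sum over t is a block of
   the sum over k, whose other terms are nonnegative. *)
have [|md] := posnP m; first move=> ->.
  by rewrite big_ord0; apply: sumr_ge0 => k _; exact: F0.
have -> : \sum_(t < m | P t) F (ulen y + t)%N =
    \sum_(ulen y <= k < ulen y + m | `[< Om N k b >]) F k.
  by rewrite -{2}[ulen y]add0n big_addn addKn big_mkord;
    apply: eq_big => [t|t _]; rewrite addnC.
rewrite -(big_mkord (fun k => `[< Om N k b >]) F).
have yn : (ulen y + m <= n)%N by lia.
rewrite [leRHS](@big_cat_nat _ _ _ (ulen y)) //=; last lia.
rewrite [X in _ <= _ + X](@big_cat_nat _ _ _ (ulen y + m)) ?leq_addr //=.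
rewrite addrCA lerDl.
by apply: addr_ge0; apply: sumr_ge0 => k _; exact: F0.
Qed.

End Overlap.

(* [compact_cover] is stated for pointed spaces. *)
Lemma compact_cover_compact (T : topologicalType) (K : set T) :
  compact K -> cover_compact K.
Proof.
move=> cK I D f oD KD.
have [[a Ka]|K0] := pselect (K !=set0); last first.
  by exists fset0 => // a Ka; case: K0; exists a.
pose T' : ptopologicalType := HB.pack (T : Type) T (isPointed.Build T a).
have : @compact T' K by exact: cK.
by rewrite compact_cover => /(_ I D f oD KD).
Qed.

(** * Cut-offs, uniform bounds on compact sets, and compact supports *)

Section Amenability.
Variables (R : realType) (G : ultragraph).
Implicit Types (g h : ugpd G) (a b : unit_space G) (x y z : upath G).
Local Notation lc := (locally_compact [set: ugpd G]).

(** Compactness is asked only where [Cc] demands compact supports; without local compactness [setT]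
    is allowed. *)
Definition cutoff (C : set (unit_space G)) : Prop :=
  clopen C /\ (lc -> compact C).

(** A compact neighbourhood of the unit arrow at a pulls back along [ug_id] to a neighbourhood of a.
    A clopen W inside it is closed in the compact image under the range map. *)
Lemma compact_clopen_nbhs : lc -> forall a,
  exists W : set (unit_space G), [/\ clopen W, compact W & W a].
Proof.
move=> lcG a; have [U] := lcG (ug_id a) I; rewrite /within /= => aU [cU _].
have idc : continuous (@ug_id G).
  have -> : @ug_id G = sec 0 0.
    apply/funext => b; apply: (@is_shift_inj _ 0%N); [exact: is_shift_id|exact: secP|].
    by rewrite sec_rng.
  exact: sec_continuous.
have : nbhs a (@ug_id G @^-1` U).
  have : nbhs a (@ug_id G @^-1` [set g | setT g -> U g]) := idc a _ aU.
  by apply: filterS => b; apply.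
rewrite nbhsE => -[Q [oQ Qa] QU].
have [W [cW Wa WQ]] := unit_clopen_basis oQ Qa.
exists W; split => //.
apply: (@subclosed_compact _ W (@ug_rng G @` U)) cW.2 _ _.
  apply: continuous_compact cU.
  by apply: continuous_subspaceT; exact: ug_rng_continuous.
by move=> b /WQ/QU Ub; exists (ug_id b).
Qed.

Lemma cutoffU C D : cutoff C -> cutoff D -> cutoff (C `|` D).
Proof.
move=> [cC kC] [cD kD]; split; first exact: clopenU.
by move=> l; apply: compactU; [exact: kC|exact: kD].
Qed.

Lemma cutoff_cover (K : set (unit_space G)) : compact K ->
  exists2 C, cutoff C & K `<=` C.
Proof.
have [l|nl] := pselect lc; last first.
  by exists setT => //; split => //; exact: clopenT.
move=> cK; have /(_ _ [set W | clopen W /\ compact W] id) : cover_compact K.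
  exact: compact_cover_compact.
case=> [W [[]//]||D' sD' KD'].
  move=> a Ka; have [W [cW kW Wa]] := compact_clopen_nbhs l a.
  by exists W.
exists (\big[setU/set0]_(W <- D') W).
  rewrite big_seq; elim/big_ind : _ => [|C D|W /sD'/set_mem[cW kW]].
  - by split => [|_]; [exact: clopen0|exact: compact0].
  - exact: cutoffU.
  - by [].
by move=> a /KD'[W WD' Wa]; rewrite -bigcup_seq; exists W.
Qed.

Definition edge_bounded (M : nat) x : Prop :=
  (ulen x <= M)%N /\ all (fun e => choice.pickle e < M)%N (edges x).

Lemma edge_bounded_ex x : exists M, edge_bounded M x.
Proof.
exists (maxn (ulen x) (\max_(e <- edges x) (choice.pickle e).+1)).
split; first exact: leq_maxl.
apply/allP => e ex; rewrite leq_max; apply/orP; right.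
by rewrite (big_rem e ex) leq_maxl.
Qed.

Lemma edge_bounded_le M M' x : (M <= M')%N -> edge_bounded M x -> edge_bounded M' x.
Proof.
move=> MM [xM /allP xp]; split; first exact: leq_trans MM.
by apply/allP => e /xp h; exact: leq_trans MM.
Qed.

(** For each M, the basic sets of M-bounded pairs have an open union, and these unions cover all
    arrows; the largest M in a finite subcover of K serves. *)
Lemma compact_bounded (K : set (ugpd G)) : compact K -> exists M, forall g, K g ->
  exists x y, [/\ urng x = urng y, ubasic x y setT g, edge_bounded M x
    & edge_bounded M y].
Proof.
move=> cK; have /(_ nat setT (fun M => \bigcup_(p in
  [set p : upath G * upath G | [/\ urng p.1 = urng p.2, edge_bounded M p.1
    & edge_bounded M p.2]]) ubasic p.1 p.2 setT)) : cover_compact K.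
  exact: compact_cover_compact.
case=> [M _||D' _ KD'].
- by apply: bigcup_open => p [rp _ _]; exact: ubasic_open rp openT.
- move=> g _; have [x [y [rxy /(_ setT I) gxy]]] := ugpd_ubasic g.
  have [M xM] := edge_bounded_ex x; have [M' yM'] := edge_bounded_ex y.
  exists (maxn M M') => //; exists (x, y) => //; split => //=.
    by apply: edge_bounded_le xM; exact: leq_maxl.
  by apply: edge_bounded_le yM'; exact: leq_maxr.
exists (\max_(M <- D') M) => g /KD'[M /= MD' [[x y] [rxy xM yM] gxy]].
have le : (M <= \max_(M <- D') M)%N by rewrite (big_rem M MD') leq_maxl.
by exists x, y; split => //; exact: edge_bounded_le le _.
Qed.

Lemma fwt_supp_clopen N n (C : set (unit_space G)) : clopen C ->
  clopen [set g | fwt R N n C g != 0].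
Proof.
move=> cC; apply: locally_constant_clopen => g.
have : nbhs g [set h | fwt R N n C h = fwt R N n C g] := fwt_near R N n g cC.
by rewrite nbhsE => -[Q gQ QE]; exists Q => // h /QE /= ->.
Qed.

(** The set is a finite union of the compact images of K under [sec N k], each cut by a clopen
    set. *)
Lemma fwt_support_compact N n (C : set (unit_space G)) (K : set (unit_space G)) :
  clopen C -> compact K ->
  compact ([set g | fwt R N n C g != 0] `&` @ug_rng G @^-1` K).
Proof.
move=> cC cK.
have -> : [set g | fwt R N n C g != 0] `&` @ug_rng G @^-1` K =
    \big[setU/set0]_(k < n) (sec N k @` K `&` [set g | fwt R N n C g != 0]).
  rewrite -(bigcup_mkord n (fun k => sec N k @` K `&`
    [set g | fwt R N n C g != 0])); apply/seteqP; split => g.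
    move=> [g0 Kg]; have [k [kn _ gk ak]] := fwt_neq0 g0.
    exists k => //; split => //; exists (ug_rng g) => //.
    by apply: is_shift_inj (secP ak) gk _; rewrite sec_rng.
  by move=> [k _ [[a Ka <-] g0]]; split => //=; rewrite sec_rng.
apply: bigsetU_compact => k _; apply: compact_closedI.
  apply: continuous_compact cK.
  by apply: continuous_subspaceT; exact: sec_continuous.
exact: (fwt_supp_clopen N n cC).2.
Qed.

End Amenability.

Theorem theorem30 (R : realType) (G : ultragraph) :
  no_sinks G -> amenable R (ultrapath_groupoid G).
Proof.
move=> _.
(* An index is (n, N, C); the walk is observed at n + 1 times, so the denominator is never 0. *)
pose I := (nat * nat * {C : set (unit_space G) | cutoff C})%type.
pose le (i j : I) := [/\ (i.1.1 <= j.1.1)%N, (i.1.2 <= j.1.2)%N &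
  sval i.2 `<=` sval j.2].
pose w (i : I) := fwt R i.1.2 i.1.1.+1 (sval i.2).
pose f (i : I) (g : ugpd G) : R[i] := (w i g)%:C%C.
have f0 i g : f i g != 0 -> w i g != 0.
  by apply: contra_neq; rewrite /f => ->.
have suppE i : [set g | f i g != 0] = [set g | w i g != 0].
  apply/seteqP; split => g /=; first exact: f0.
  by apply: contra_neq => /complexI.
exists I, le, f; split.
- split.
  + have cutoff0 : cutoff (set0 : set (unit_space G)).
      by split => [|_]; [exact: clopen0|exact: compact0].
    by constructor; exact: (0%N, 0%N, exist _ _ cutoff0).
  + by move=> i; split.
  + move=> i j k [h1 h2 h3] [h4 h5 h6]; split; [exact: leq_trans h4|
      exact: leq_trans h5|exact: subset_trans h6].
  + move=> i j; exists (maxn i.1.1 j.1.1, maxn i.1.2 j.1.2,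
      exist _ _ (cutoffU (svalP i.2) (svalP j.2))).
    by split; split => /=; rewrite ?leq_maxl ?leq_maxr.
- move=> i; have [cC kC] := svalP i.2.
  (* The set where f is nonzero is clopen, so its closure adds nothing. *)
  have supp_i : @supp R (ultrapath_groupoid G) (f i) = [set g | w i g != 0].
    by rewrite /supp suppE; apply/esym/closure_id; exact: (fwt_supp_clopen _ _ _ cC).2.
  split.
  + move=> g P fgP.
    suff : nbhs g (f i @^-1` P) by [].
    apply: filterS (fwt_near R i.1.2 i.1.1.+1 g cC) => h hE.
    by rewrite /preimage /= /f /w hE; exact: (nbhs_singleton fgP).
  + by move=> K cK; rewrite supp_i; exact: fwt_support_compact.
  + move=> l; rewrite supp_i.
    (* The whole support lies over the cut-off, which is compact here. *)
    have := @fwt_support_compact R G i.1.2 i.1.1.+1 _ _ cC (kC l).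
    congr compact; apply/seteqP; split => g; first by case.
    by move=> g0; split => //; have [k []] := fwt_neq0 g0.
- exists 1 => i u.
  rewrite (@fibre_sum_sec _ _ _ i.1.2 i.1.1.+1); last first.
    move=> h hu fh; have /f0/fwt_neq0[k [kn _ hk]] : f i h != 0.
      by apply: contra_neq fh => ->; rewrite normr0 expr0n.
    by rewrite hu; exists k.
  rewrite (eq_bigr (fun k : 'I_ _ => (w i (sec i.1.2 k u) ^+ 2)%:C%C)).
    by rewrite -rmorph_sum lecR; exact: fwt_norm.
  move=> k _; rewrite /f normc_def /= expr0n addr0 sqrtr_sqr.
  by rewrite ger0_norm ?fwt_ge0 // rmorphXn.
- move=> K cK e e0.
  have [M KM] := compact_bounded cK.
  have ccont (q : ugpd G -> unit_space G) : continuous q -> compact (q @` K).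
    move=> cq; apply: continuous_compact cK; exact: continuous_subspaceT.
  have [C gC KC] := cutoff_cover (ccont _ (@ug_rng_continuous G)).
  have [D gD KD] := cutoff_cover (ccont _ (@ug_src_continuous G)).
  (* Beyond this index M / (n + 1) < e, the letters of all x and y involved lie in F_N, and the
     cut-off contains the ranges and sources of K. *)
  exists (Num.bound (M%:R / e), M, exist _ _ (cutoffU gC gD)).
  move=> [[n N] [B gB]] [/= Mn MN CDB] g Kg.
  have [x [y [rxy gxy xM yM]]] := KM g Kg.
  have [_ xN] := edge_bounded_le MN xM; have [_ yN] := edge_bounded_le MN yM.
  rewrite (@fibre_sum_sec _ _ _ N n.+1); last first.
    move=> h hu fh; have /f0/fwt_neq0[k [kn _ hk]] : f (n, N, exist _ B gB) h != 0.
      by apply: contra_neq fh => ->; rewrite conjC0 mulr0.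
    by rewrite hu; exists k.
  rewrite (eq_bigr (fun k : 'I_ _ => (fwt R N n.+1 B (ug_mul g (sec N k (ug_src g)))
    * fwt R N n.+1 B (sec N k (ug_src g)))%:C%C)); last first.
    by move=> k _; rewrite rmorphM; congr (_ * _); exact: conjc_real.
  rewrite -rmorph_sum.
  have Bg : B (ug_rng g) by apply: CDB; left; apply: KC; exists g.
  have Bs : B (ug_src g) by apply: CDB; right; apply: KD; exists g.
  (* The overlap thus lies between 1 - M / (n + 1) and 1. *)
  have := overlap_ge R (ltn0Sn n) rxy gxy xN yN Bg Bs.
  have := overlap_le R N B g (ltn0Sn n).
  move: (\sum_(k < _ | _) _) => S S1 Sge.
  have -> : (S%:C - 1)%C = (S - 1)%:C%C :> R[i] by rewrite rmorphB rmorph1.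
  rewrite normc_def /= expr0n addr0 sqrtr_sqr ltcR.
  rewrite ler0_norm ?subr_le0 // opprB ltrBlDr -ltrBlDl.
  apply: lt_le_trans Sge; rewrite ltr_pdivlMr ?ltr0n //.
  set d := maxn _ _; have dM : (d <= M)%N by rewrite geq_max xM.1 yM.1.
  have nM : M%:R < e * n.+1%:R.
    rewrite mulrC -ltr_pdivrMr //.
    apply: lt_le_trans (archi_boundP _) _; first by rewrite divr_ge0 // ltW.
    by rewrite ler_nat; exact: leqW.
  have : n.+1%:R <= (n.+1 - d)%N%:R + d%:R :> R.
    by rewrite -natrD ler_nat; lia.
  have : d%:R <= M%:R :> R by rewrite ler_nat.
  rewrite mulrBl mul1r; lra.
Qed.
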